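(* Let $\mathcal C\subseteq\mathbb R^2$ be a circle with center $O$ and radius $r>0$. Let $A\in\mathbb R^2$ be a radiant point with $A\notin\mathcal C$ and $A\neq O$, and define $$B:=O+\frac{r^2}{\|A-O\|^2}(A-O).$$ Fix a real number $n\neq 0$. Then the set of refracted rays (for the radiant point $A$ and the curve $\mathcal C$) for the refraction constants $n$ and $-n$ that do not meet $A$ or $B$ coincides with the set of normals, excluding the line $L_{AO}$, to the real curves among the four Cartesian ovals $$\|A-M\|+\sigma_1\frac{\|A-O\|}{r}\|B-M\|=\sigma_2\frac{\|A-O\|\,\|A-B\|}{r|n|},\qquad \sigma_1,\sigma_2\in\{-1,1\}.$$ In other words, the complete caustic by refraction (given $A$, $\mathcal C$ and $n$) is the evolute of the union of those real Cartesian ovals.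
   Context: $\|\cdot\|$ is the Euclidean norm on $\mathbb R^2$, and $L_{PQ}$ denotes the line spanned by two distinct points $P,Q$. Refracted rays. Fix a radiant point $A\in\mathbb R^2$ and a plane curve $\mathcal C$. For a smooth point $X\in\mathcal C$, $X\ne A$, the light ray $L(X)$ is the line through $A$ and $X$, and $N(X)$ is the normal line of $\mathcal C$ at $X$. For two lines $L_0,L_1$ meeting at $X$, the angle of $L_1$ with respect to $L_0$ is the unique $\theta\in(-\pi/2,\pi/2]$ by which $L_0$ must be rotated around $X$ to become $L_1$. Let $\theta_{\mathrm{in}}$ be the angle of $L(X)$ with respect to $N(X)$. For a real $n\ne0$ (the refraction constant) with $\frac1n\sin\theta_{\mathrm{in}}\in[-1,1]$, the refracted ray $R_n(X)$ is the line through $X$ whose angle $\theta_{\mathrm{out}}$ with respect to $N(X)$ satisfies $\sin\theta_{\mathrm{in}}=n\sin\theta_{\mathrm{out}}$ (with $\theta_{\mathrm{out}}=0$ if $\theta_{\mathrm{in}}=0$). Refracted rays are full lines. The envelope of a family of curves in the plane is a curve that is tangent to each curve of the family at some point, such that these points of tangency form the whole curve. The complete caustic by refraction given $A,\mathcal C,n$ is the envelope of all refracted rays $R_n(X)$ and $R_{-n}(X)$. The evolute of a plane curve is the envelope of its family of normal lines (normals), taken at smooth points. Cartesian ovals. For distinct points $A,B\in\mathbb R^2$ (foci) and real $s,t$, the set of $M\in\mathbb R^2$ with $\|A-M\|+s\|B-M\|=t$ is called a Cartesian oval. Depending on the parameters and signs this set may be empty, a single point, or a real curve; only those that are real curves are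 considered in the claim.
   Formalization: The closing caustic/evolute sentence is stated for all refracted rays only when |n| is neither 1 nor ‖A−O‖/r, since otherwise a pencil of rays through A or B has no tangency with the evolute; for every n it is stated with the rays through A or B (except L_AO) discarded. *)

(* Defs.v *)
From Stdlib Require Import Reals.
From Coquelicot Require Import Coquelicot.
Open Scope R_scope.

(* Coquelicot's norm on a product module is
   [sqrt (norm (fst P) ^ 2 + norm (snd P) ^ 2)], i.e. the Euclidean norm. *)
Definition plane : NormedModule R_AbsRing :=
  prod_NormedModule R_AbsRing R_NormedModule R_NormedModule.

Definition pset : Type := plane -> Prop.

Definition same (S T : pset) : Prop := forall P, S P <-> T P.

Definition line (P v : plane) : pset :=
  fun Q => exists k : R, Q = plus P (scal k v).

Definition line_through (P Q : plane) : pset := line P (minus Q P).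

Definition circle (O : plane) (r : R) : pset := fun P => norm (minus P O) = r.

(* Near [X], the set [C] is the zero set of the C^1 function [F], whose
   gradient [(Fx, Fy)] does not vanish at [X]. *)
Definition regular_equation (C : pset) (X : plane) (F Fx Fy : plane -> R)
  : Prop :=
  locally X (fun Q : plane =>
    (C Q <-> F Q = 0) /\
    is_derive (fun x : R => F (x, snd Q)) (fst Q) (Fx Q) /\
    is_derive (fun y : R => F (fst Q, y)) (snd Q) (Fy Q) /\
    continuous Fx Q /\ continuous Fy Q) /\
  (Fx X <> 0 \/ Fy X <> 0).

Definition smooth_point (C : pset) (X : plane) : Prop :=
  C X /\ exists F Fx Fy, regular_equation C X F Fx Fy.

Definition normal_at (C : pset) (X : plane) (N : pset) : Prop :=
  C X /\ exists F Fx Fy,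
    regular_equation C X F Fx Fy /\ same N (line X (Fx X, Fy X)).

Definition normals (C : pset) (N : pset) : Prop := exists X, normal_at C X N.

Definition rotation (X : plane) (theta : R) (Q : plane) : plane :=
  let d : plane := minus Q X in
  plus X (cos theta * fst d - sin theta * snd d,
          sin theta * fst d + cos theta * snd d).

(* [theta] is the angle of [L1] with respect to [L0], two lines through [X]. *)
Definition line_angle (X : plane) (L0 L1 : pset) (theta : R) : Prop :=
  - PI / 2 < theta <= PI / 2 /\
  same L1 (fun P => exists Q, L0 Q /\ P = rotation X theta Q).

(* When [sin theta_in = - n], the value [theta_out = - PI / 2] lies outside
   the range of angles, so no line is produced for [n]; the tangent line at [X]
   is then produced for [- n]. *)
Definition refracted_ray (A : plane) (C : pset) (n : R) (X : plane) (L : pset)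
  : Prop :=
  X <> A /\
  exists (N : pset) (theta_in theta_out : R),
    normal_at C X N /\
    line_angle X N (line_through A X) theta_in /\
    -1 <= / n * sin theta_in <= 1 /\
    line_angle X N L theta_out /\
    sin theta_in = n * sin theta_out /\
    (theta_in = 0 -> theta_out = 0).

(* The rays [R_n(X)] and [R_{-n}(X)]. *)
Definition refracted_rays (A : plane) (C : pset) (n : R) (L : pset) : Prop :=
  exists X, refracted_ray A C n X L \/ refracted_ray A C (- n) X L.

(* [v] spans a limit of secants of [C] through [P]; this makes sense also at
   the cusps and double points that evolutes and caustics have. *)
Definition tangent_direction (C : pset) (P v : plane) : Prop :=
  C P /\ v <> zero /\
  forall eps, 0 < eps -> exists Q : plane,
    C Q /\ Q <> P /\ norm (minus Q P) < eps /\
    Rabs (fst (minus Q P) * snd v - snd (minus Q P) * fst v)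
      <= eps * norm (minus Q P) * norm v.

Definition tangent_at (C D : pset) (P : plane) : Prop :=
  exists v, tangent_direction C P v /\ tangent_direction D P v.

Definition plane_curve (C : pset) : Prop :=
  (exists P, C P) /\
  forall P, C P -> forall eps, 0 < eps ->
    exists Q, smooth_point C Q /\ norm (minus Q P) < eps.

Definition is_envelope (family : pset -> Prop) (E : pset) : Prop :=
  plane_curve E /\
  (forall L, family L -> exists P, tangent_at L E P) /\
  (forall P, E P -> exists L, family L /\ tangent_at L E P).

Definition is_complete_caustic (A : plane) (C : pset) (n : R) (E : pset)
  : Prop := is_envelope (refracted_rays A C n) E.

Definition is_evolute (C E : pset) : Prop := is_envelope (normals C) E.

Definition cartesian_oval (A B : plane) (s t : R) : pset :=
  fun M => norm (minus A M) + s * norm (minus B M) = t.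

(* A Cartesian oval is empty, a single point, or a real curve. *)
Definition is_real_curve (C : pset) : Prop := exists P Q, C P /\ C Q /\ P <> Q.

Definition is_sign (sigma : R) : Prop := sigma = -1 \/ sigma = 1.

(* Here [a = |A - O|]. *)
Definition oval (A B : plane) (a r n sigma1 sigma2 : R) : pset :=
  cartesian_oval A B (sigma1 * (a / r))
    (sigma2 * (a * norm (minus A B) / (r * Rabs n))).

Definition real_oval (A B : plane) (a r n : R) (C : pset) : Prop :=
  exists sigma1 sigma2, is_sign sigma1 /\ is_sign sigma2 /\
    same C (oval A B a r n sigma1 sigma2) /\ is_real_curve C.

Definition real_ovals_union (A B : plane) (a r n : R) : pset :=
  fun M => exists C, real_oval A B a r n C /\ C M.

(* Main.v *)
(* The normal of the circle at [X] is tangent to the circle [K] through [A], [B]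
   and [X], since [A] and [B] are inverse points.  A line through [X] meets [K]
   again at some [M].  By the law of sines in [K], [|MX| / |AX|] is the ratio of
   the sines of the angles which the line and [L(X)] make with the normal, so the
   line is a refracted ray iff [|MX| = |AX| / |n|].  As
   [|XA| : |XB| = |AO| : r], Ptolemy's theorem for [A, B, M, X] turns this into
   the equation of one of the four ovals, and the ratio of the sines of the angles
   [AMX] and [BMX] says that [MX] is normal to that oval.  Conversely, [X] is
   recovered as the second intersection of the normal at [M] with [K].  At a focus
   lying on a real oval, the oval has two transversal branches, so no normal is
   defined there; hence distinct ovals do not interfere in the union. *)
Require Import Defs.
From Stdlib Require Import Reals Lra Nsatz Ranalysis5 Classical.
From Coquelicot Require Import Coquelicot.
Open Scope R_scope.

(** * Normals of plane sets *)

(** [normal_at] admits any C^1 equation of the set near the point, so two facts about arbitrary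
    equations carry the geometric part: a tangent vector of the equation is a limit of secants of
    the set, and the gradient is orthogonal to every such limit. Together they make the normal
    independent of the equation. At a focus, two independent limits of secants exclude every
    equation, even one for the union of the ovals. Since [A] is off the circle, [a / r] differs from
    1, which keeps the gradient of an oval from vanishing away from the foci. Regular points are not
    isolated, so an oval that has a normal is automatically a real curve. Lines carry no
    orientation, hence Snell's law is used in squared form, as a relation between cross products;
    this is exactly what treating [n] and [- n] together allows. The signs lost by squaring come
    back as [sigma1] and [sigma2]. The axis [L_AO], for which the circle [K] degenerates, is treated
    apart: it is always both a refracted ray and a normal, which makes the two families of lines in
    the envelope clauses equal. *)

Lemma sum_sqr_pos (x y : R) : x <> 0 \/ y <> 0 -> 0 < x ^ 2 + y ^ 2.
Proof.
  pose proof (pow2_ge_0 x). pose proof (pow2_ge_0 y).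
  intros [h | h]; apply pow2_gt_0 in h; lra.
Qed.

Lemma norm_plane (P : plane) : norm P = sqrt (fst P ^ 2 + snd P ^ 2).
Proof.
  assert (Hsq : forall x : R, Rabs x * (Rabs x * 1) = x * (x * 1)).
  { intro x. rewrite !Rmult_1_r. symmetry. apply (Rsqr_abs x). }
  unfold norm; simpl. unfold prod_norm; simpl. unfold norm; simpl.
  unfold abs; simpl. now rewrite !Hsq.
Qed.

Definition dist2 (x y a b : R) : R := sqrt ((x - a) ^ 2 + (y - b) ^ 2).

Lemma norm_minus (x y a b : R) :
  norm (minus (x, y) (a, b) : plane) = dist2 x y a b.
Proof. rewrite norm_plane. reflexivity. Qed.

(** Secants have arbitrary slopes, so the estimates below need a total differential; continuity of
    the partial derivatives provides it. *)
Lemma regular_differentiable (C : pset) (Q : plane) (F Fx Fy : plane -> R) :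
  locally Q (fun Q : plane =>
    (C Q <-> F Q = 0) /\
    is_derive (fun x : R => F (x, snd Q)) (fst Q) (Fx Q) /\
    is_derive (fun y : R => F (fst Q, y)) (snd Q) (Fy Q) /\
    continuous Fx Q /\ continuous Fy Q) ->
  differentiable_pt_lim (fun x y => F (x, y)) (fst Q) (snd Q) (Fx Q) (Fy Q).
Proof.
  intros H. destruct Q as [a b].
  apply filterdiff_differentiable_pt_lim.
  pose proof (is_derive_filterdiff (fun x y => F (x, y)) a b
                (fun x y => Fx (x, y)) (Fy (a, b))) as K.
  eapply filterdiff_ext_lin; [apply K |].
  - apply filter_imp with (2 := H). intros [u v] [_ [h _]]; exact h.
  - apply (locally_singleton _ _ H).
  - apply (continuous_ext Fx); [intros [u v]; reflexivity |].
    apply (locally_singleton _ _ H).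
  - intros [u v]. reflexivity.
Qed.

(* [v] is a one-sided limit of secant directions of [C] at [X]. *)
Definition contingent (C : pset) (X : plane) (v1 v2 : R) : Prop :=
  forall eps, 0 < eps -> exists h w1 w2, 0 < h < eps /\
    Rabs (w1 - v1) < eps /\ Rabs (w2 - v2) < eps /\
    C (fst X + h * w1, snd X + h * w2).

(** The curve is written as [X + h * w h], so that its one-sided tangent at [X] only requires
    continuity of [w] at 0. *)
Lemma contingent_curve (C : pset) (X : plane) (w1 w2 : R -> R) (delta : R) :
  0 < delta -> continuity_pt w1 0 -> continuity_pt w2 0 ->
  (forall h, 0 < h < delta -> C (fst X + h * w1 h, snd X + h * w2 h)) ->
  contingent C X (w1 0) (w2 0).
Proof.
  intros Hd H1 H2 HC eps Heps.
  destruct (H1 eps Heps) as (d1 & Hd1 & K1).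
  destruct (H2 eps Heps) as (d2 & Hd2 & K2).
  set (m := Rmin (Rmin delta eps) (Rmin d1 d2)).
  assert (Hm : 0 < m) by (unfold m; repeat apply Rmin_glb_lt; lra).
  assert (Hm1 : m <= delta /\ m <= eps /\ m <= d1 /\ m <= d2).
  { unfold m.
    pose proof (Rmin_l (Rmin delta eps) (Rmin d1 d2)).
    pose proof (Rmin_r (Rmin delta eps) (Rmin d1 d2)).
    pose proof (Rmin_l delta eps). pose proof (Rmin_r delta eps).
    pose proof (Rmin_l d1 d2). pose proof (Rmin_r d1 d2). lra. }
  assert (Hdist : forall d, m <= d -> D_x no_cond 0 (m / 2) /\
                     Rabs (m / 2 - 0) < d).
  { intros d Hmd. split.
    - split; [exact I | lra].
    - rewrite Rabs_pos_eq; lra. }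
  exists (m / 2), (w1 (m / 2)), (w2 (m / 2)). repeat split; try lra.
  - apply K1, Hdist; lra.
  - apply K2, Hdist; lra.
  - apply HC; lra.
Qed.

(** [F] vanishes at [X] and at the end of the secant, so the linear term [h * (p * w1 + q * w2)] is
    [o(h)]. *)
Lemma contingent_orthogonal (C : pset) (X : plane) (F Fx Fy : plane -> R)
    (v1 v2 : R) :
  regular_equation C X F Fx Fy -> C X -> contingent C X v1 v2 ->
  Fx X * v1 + Fy X * v2 = 0.
Proof.
  intros [H _] HX Hv.
  pose proof (regular_differentiable C X F Fx Fy H) as Hd.
  assert (F0 : F X = 0) by (apply (locally_singleton _ _ H); exact HX).
  destruct X as [a b]. change (F (@pair R R a b) = 0) in F0. cbn [fst snd] in *.
  set (p := Fx (a, b)) in *. set (q := Fy (a, b)) in *.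
  destruct (Req_dec (p * v1 + q * v2) 0) as [|Hne]; [assumption | exfalso].
  set (m := Rabs (p * v1 + q * v2)).
  assert (Hm : 0 < m) by now apply Rabs_pos_lt.
  set (V := Rabs v1 + Rabs v2 + 1).
  set (G := Rabs p + Rabs q + 1).
  assert (HV : 1 <= V)
    by (unfold V; pose proof (Rabs_pos v1); pose proof (Rabs_pos v2); lra).
  assert (HG : 1 <= G)
    by (unfold G; pose proof (Rabs_pos p); pose proof (Rabs_pos q); lra).
  assert (He : 0 < m / (4 * V)) by (apply Rdiv_lt_0_compat; lra).
  destruct (Hd (mkposreal _ He)) as [d1 Hd1].
  destruct (proj2 (locally_2d_locally (fun x y => C (x, y) <-> F (x, y) = 0) a b))
    as [d2 Hd2].
  { apply filter_imp with (2 := H). intros [u v] [h _]; exact h. }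
  pose proof (cond_pos d1). pose proof (cond_pos d2).
  set (dl := Rmin d1 d2).
  assert (Hdl : 0 < dl /\ dl <= d1 /\ dl <= d2).
  { unfold dl; repeat split; [now apply Rmin_glb_lt | apply Rmin_l | apply Rmin_r]. }
  (* This [e] keeps the secant inside the neighbourhood and [w] below [V]; passing from [w] to [v]
     then costs at most [G * e <= m / 4]. The remainder of the differential costs another [m / 4],
     so that [m <= m / 2]. *)
  set (e := Rmin (dl / V) (Rmin 1 (m / (4 * G)))).
  assert (Hmg : 0 < m / (4 * G)) by (apply Rdiv_lt_0_compat; lra).
  assert (Hdv : 0 < dl / V) by (apply Rdiv_lt_0_compat; lra).
  assert (Hepos : 0 < e) by (unfold e; repeat apply Rmin_glb_lt; lra).
  assert (Hel : e <= dl / V /\ e <= 1 /\ e <= m / (4 * G)).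
  { unfold e. pose proof (Rmin_l (dl / V) (Rmin 1 (m / (4 * G)))).
    pose proof (Rmin_r (dl / V) (Rmin 1 (m / (4 * G)))).
    pose proof (Rmin_l 1 (m / (4 * G))). pose proof (Rmin_r 1 (m / (4 * G))). lra. }
  destruct (Hv e Hepos) as (h & w1 & w2 & Hh & Hw1 & Hw2 & HC).
  assert (Bw : forall w v, Rabs (w - v) < e -> Rabs v + 1 <= V -> Rabs w <= V).
  { intros w v Hw Hvv. replace w with ((w - v) + v) by ring.
    pose proof (Rabs_triang (w - v) v). lra. }
  assert (B1 : Rabs w1 <= V)
    by (apply (Bw w1 v1); [assumption | unfold V; pose proof (Rabs_pos v2); lra]).
  assert (B2 : Rabs w2 <= V)
    by (apply (Bw w2 v2); [assumption | unfold V; pose proof (Rabs_pos v1); lra]).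
  assert (HhV : h * V < dl).
  { apply Rlt_le_trans with (dl / V * V); [apply Rmult_lt_compat_r; lra |].
    right; field; lra. }
  assert (S : forall w, Rabs w <= V -> forall c, Rabs (c + h * w - c) <= h * V).
  { intros w Hw c. replace (c + h * w - c) with (h * w) by ring.
    rewrite Rabs_mult, (Rabs_pos_eq h) by lra. apply Rmult_le_compat_l; lra. }
  pose proof (S w1 B1 a) as S1. pose proof (S w2 B2 b) as S2.
  assert (FQ : F (a + h * w1, b + h * w2) = 0) by (apply Hd2; [lra | lra | assumption]).
  specialize (Hd1 (a + h * w1) (b + h * w2) ltac:(lra) ltac:(lra)).
  cbn [pos] in Hd1. rewrite FQ, F0 in Hd1.
  replace (0 - 0 - (p * (a + h * w1 - a) + q * (b + h * w2 - b)))
    with (- (h * (p * w1 + q * w2))) in Hd1 by ring.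
  rewrite Rabs_Ropp, Rabs_mult, (Rabs_pos_eq h) in Hd1 by lra.
  assert (K : Rabs (p * w1 + q * w2) <= m / 4).
  { apply Rmult_le_reg_l with h; [lra |].
    apply Rle_trans with (1 := Hd1).
    apply Rle_trans with (m / (4 * V) * (h * V)).
    - apply Rmult_le_compat_l; [lra | now apply Rmax_lub].
    - right; field; lra. }
  assert (K2 : m <= Rabs (p * w1 + q * w2) + G * e).
  { unfold m.
    replace (p * v1 + q * v2) with
      ((p * w1 + q * w2) + (- (p * (w1 - v1)) + - (q * (w2 - v2)))) by ring.
    eapply Rle_trans; [apply Rabs_triang |]. apply Rplus_le_compat_l.
    eapply Rle_trans; [apply Rabs_triang |].
    rewrite !Rabs_Ropp, !Rabs_mult. unfold G.
    pose proof (Rabs_pos p). pose proof (Rabs_pos q).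
    assert (Rabs p * Rabs (w1 - v1) <= Rabs p * e) by (apply Rmult_le_compat_l; lra).
    assert (Rabs q * Rabs (w2 - v2) <= Rabs q * e) by (apply Rmult_le_compat_l; lra).
    lra. }
  assert (K3 : G * e <= m / 4).
  { apply Rle_trans with (G * (m / (4 * G))).
    - apply Rmult_le_compat_l; lra.
    - right; field; lra. }
  lra.
Qed.

(* Near a regular point the defining function changes sign across the tangent
   line, so the intermediate value theorem yields points of the set along it. *)
Lemma regular_contingent (C : pset) (X : plane) (F Fx Fy : plane -> R) :
  regular_equation C X F Fx Fy -> C X -> contingent C X (- Fy X) (Fx X).
Proof.
  intros [H Hnz] HX eps0 Heps0.
  pose proof (regular_differentiable C X F Fx Fy H) as Hd.
  assert (F0 : F X = 0) by (apply (locally_singleton _ _ H); exact HX).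
  pose proof (locally_locally _ _ H) as HH.
  destruct X as [a b]. change (F (@pair R R a b) = 0) in F0. cbn [fst snd] in *.
  set (p := Fx (a, b)) in *. set (q := Fy (a, b)) in *.
  assert (HN : 0 < p ^ 2 + q ^ 2) by now apply sum_sqr_pos.
  set (N := p ^ 2 + q ^ 2) in *.
  set (G := Rabs p + Rabs q + 1).
  assert (HG : Rabs p <= G /\ Rabs q <= G /\ 1 <= G)
    by (unfold G; pose proof (Rabs_pos p); pose proof (Rabs_pos q); lra).
  set (eps := Rmin 1 (eps0 / (2 * G))).
  assert (Hmg : 0 < eps0 / (2 * G)) by (apply Rdiv_lt_0_compat; lra).
  assert (Heps : 0 < eps) by (unfold eps; apply Rmin_glb_lt; lra).
  assert (Hel : eps <= 1 /\ eps * G <= eps0 / 2).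
  { split; [apply Rmin_l |].
    apply Rle_trans with (eps0 / (2 * G) * G).
    - apply Rmult_le_compat_r; [lra | apply Rmin_r].
    - right; field; lra. }
  assert (He : 0 < eps * N / (4 * G)) by (apply Rdiv_lt_0_compat; nra).
  destruct (Hd (mkposreal _ He)) as [d1 Hd1].
  destruct (proj2 (locally_2d_locally (fun x y => (C (x, y) <-> F (x, y) = 0) /\
      differentiable_pt_lim (fun x y => F (x, y)) x y (Fx (x, y)) (Fy (x, y))) a b))
    as [d2 Hd2].
  { apply filter_imp with (2 := HH). intros [u v] h. split.
    - apply (locally_singleton _ _ h).
    - exact (regular_differentiable C (u, v) F Fx Fy h). }
  pose proof (cond_pos d1). pose proof (cond_pos d2).
  set (dl := Rmin (Rmin d1 d2) eps0).
  assert (Hdl : 0 < dl /\ dl <= d1 /\ dl <= d2 /\ dl <= eps0).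
  { unfold dl. pose proof (Rmin_l (Rmin d1 d2) eps0).
    pose proof (Rmin_r (Rmin d1 d2) eps0).
    pose proof (Rmin_l d1 d2). pose proof (Rmin_r d1 d2).
    repeat split; try lra. repeat apply Rmin_glb_lt; lra. }
  set (h := dl / (4 * G)).
  assert (Hh : 0 < h) by (apply Rdiv_lt_0_compat; lra).
  assert (HhG : h * (2 * G) = dl / 2) by (unfold h; field; lra).
  assert (Hhe : h < eps0) by nra.
  (* The tangent vector is tilted by [t] times the gradient. To first order this changes [F] by
     [h * t * N], and the error [h * eps * N / 2] cannot alter the sign at [t = - eps] or
     [t = eps]. *)
  set (w1 := fun t => - q + t * p). set (w2 := fun t => p + t * q).
  assert (Bt : forall t x y, - eps <= t <= eps -> Rabs x <= G -> Rabs y <= G ->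
                 Rabs (x + t * y) <= 2 * G).
  { intros t x y Ht Hx Hy. eapply Rle_trans; [apply Rabs_triang |].
    rewrite Rabs_mult.
    assert (Rabs t <= 1) by (apply Rabs_le; lra).
    pose proof (Rabs_pos t). pose proof (Rabs_pos y). nra. }
  assert (S : forall w, Rabs w <= 2 * G -> forall c,
             Rabs (c + h * w - c) <= h * (2 * G)).
  { intros w Hw c. replace (c + h * w - c) with (h * w) by ring.
    rewrite Rabs_mult, (Rabs_pos_eq h) by lra. apply Rmult_le_compat_l; lra. }
  assert (S1 : forall t, - eps <= t <= eps ->
             Rabs (a + h * w1 t - a) <= h * (2 * G)).
  { intros t Ht. apply S, Bt; try lra. rewrite Rabs_Ropp; lra. }
  assert (S2 : forall t, - eps <= t <= eps ->
             Rabs (b + h * w2 t - b) <= h * (2 * G)).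
  { intros t Ht. apply S, Bt; lra. }
  set (f := fun t => F (a + h * w1 t, b + h * w2 t)).
  assert (App : forall t, - eps <= t <= eps ->
            Rabs (f t - h * t * N) <= h * eps * N / 2).
  { intros t Ht.
    specialize (Hd1 (a + h * w1 t) (b + h * w2 t)).
    cbn [pos] in Hd1. rewrite F0 in Hd1.
    replace (f t - h * t * N) with (F (a + h * w1 t, b + h * w2 t) - 0 -
        (p * (a + h * w1 t - a) + q * (b + h * w2 t - b)))
      by (unfold f, N, w1, w2; ring).
    pose proof (S1 t Ht). pose proof (S2 t Ht).
    eapply Rle_trans; [apply Hd1; lra |].
    apply Rle_trans with (eps * N / (4 * G) * (h * (2 * G))).
    - apply Rmult_le_compat_l; [lra | now apply Rmax_lub].
    - right; field; lra. }
  assert (HheN : 0 < h * eps * N)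
    by (apply Rmult_lt_0_compat; [apply Rmult_lt_0_compat |]; assumption).
  destruct (IVT_interv f (- eps) eps) as [t [Ht Hft]].
  (* Continuity of [f] on the whole segment comes from differentiability of [F] at all nearby
     points, which is why [HH] was localized. *)
  - intros t Ht. apply derivable_continuous_pt.
    pose proof (S1 t Ht). pose proof (S2 t Ht).
    destruct (Hd2 (a + h * w1 t) (b + h * w2 t) ltac:(lra) ltac:(lra)) as [_ Dt].
    refine (exist _ _ (derivable_pt_lim_comp_2d (fun x y => F (x, y))
      (fun t => a + h * w1 t) (fun t => b + h * w2 t) t _ _ (h * p) (h * q) Dt _ _)).
    + apply is_derive_Reals. unfold w1. auto_derive; [exact I | ring].
    + apply is_derive_Reals. unfold w2. auto_derive; [exact I | ring].
  - lra.
  - pose proof (App (- eps) ltac:(lra)) as K.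
    apply Rabs_le_between in K. lra.
  - pose proof (App eps ltac:(lra)) as K.
    apply Rabs_le_between in K. lra.
  - exists h, (w1 t), (w2 t).
    assert (Hts : forall x, Rabs x <= G -> Rabs (t * x) < eps0).
    { intros x Hx. rewrite Rabs_mult. assert (Rabs t <= eps) by (apply Rabs_le; lra).
      pose proof (Rabs_pos t). pose proof (Rabs_pos x).
      assert (Rabs t * Rabs x <= eps * G) by (apply Rmult_le_compat; lra). lra. }
    repeat split; try lra.
    + unfold w1. replace (- q + t * p - - q) with (t * p) by ring. apply Hts; lra.
    + unfold w2. replace (p + t * q - p) with (t * q) by ring. apply Hts; lra.
    + pose proof (S1 t Ht). pose proof (S2 t Ht).
      apply (Hd2 (a + h * w1 t) (b + h * w2 t)); [lra | lra | exact Hft].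
Qed.

(** The tangent vector of one equation is a limit of secants, hence orthogonal to the gradient of
    the other. *)
Lemma gradient_unique (C : pset) (X : plane) (F Fx Fy G Gx Gy : plane -> R) :
  C X -> regular_equation C X F Fx Fy -> regular_equation C X G Gx Gy ->
  Fx X * Gy X = Fy X * Gx X.
Proof.
  intros HX HF HG.
  pose proof (contingent_orthogonal C X F Fx Fy _ _ HF HX
                (regular_contingent C X G Gx Gy HG HX)). lra.
Qed.

Lemma regular_not_isolated (C : pset) (X : plane) (F Fx Fy : plane -> R) :
  C X -> regular_equation C X F Fx Fy -> is_real_curve C.
Proof.
  intros HX HF.
  pose proof (regular_contingent C X F Fx Fy HF HX) as K.
  destruct HF as [_ Hnz]. destruct X as [a b]. cbn [fst snd] in *.
  set (p := Fx (a, b)) in *. set (q := Fy (a, b)) in *.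
  assert (Hm : 0 < Rabs p + Rabs q).
  { destruct Hnz as [h | h]; apply Rabs_pos_lt in h;
      pose proof (Rabs_pos p); pose proof (Rabs_pos q); lra. }
  (* With this tolerance the secant vector cannot be zero: it would be off by [Rabs q] and [Rabs p],
     whose sum is twice the tolerance. *)
  destruct (K _ (Rdiv_lt_0_compat _ 2 Hm ltac:(lra)))
    as (h & w1 & w2 & Hh & H1 & H2 & HC).
  exists (a, b), (a + h * w1, b + h * w2). repeat split; try assumption.
  intro E. injection E. intros E2 E1.
  assert (w1 = 0) by nra. assert (w2 = 0) by nra. subst w1 w2.
  revert H1 H2. replace (0 - - q) with q by ring.
  replace (0 - p) with (- p) by ring. rewrite Rabs_Ropp. lra.
Qed.

(** * Lines and regular equations *)

Lemma dist2_nonneg (x y a b : R) : 0 <= dist2 x y a b.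
Proof. apply sqrt_pos. Qed.

Lemma dist2_sqr (x y a b : R) : dist2 x y a b ^ 2 = (x - a) ^ 2 + (y - b) ^ 2.
Proof.
  unfold dist2. rewrite pow2_sqrt; [reflexivity |].
  apply Rplus_le_le_0_compat; apply pow2_ge_0.
Qed.

Lemma dist2_eq (x y a b e : R) :
  0 <= e -> e ^ 2 = (x - a) ^ 2 + (y - b) ^ 2 -> dist2 x y a b = e.
Proof. intros He E. unfold dist2. rewrite <- E. now apply sqrt_pow2. Qed.

Lemma dist2_pos (x y a b : R) : (x, y) <> (a, b) -> 0 < dist2 x y a b.
Proof.
  intros H. pose proof (dist2_nonneg x y a b). pose proof (dist2_sqr x y a b).
  destruct (Req_dec (dist2 x y a b) 0) as [E |]; [| lra].
  exfalso. apply H.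
  destruct (Rplus_sqr_eq_0 (x - a) (y - b)) as [E1 E2];
    [unfold Rsqr; nra | f_equal; lra].
Qed.

Lemma line_iff (x y v1 v2 a b : R) : v1 <> 0 \/ v2 <> 0 ->
  (line (x, y) (v1, v2) (a, b) <-> v1 * (b - y) = v2 * (a - x)).
Proof.
  intros Hv. split.
  - intros [k E]. injection E as E1 E2.
    change (a = x + k * v1) in E1. change (b = y + k * v2) in E2. subst. ring.
  - intros E.
    destruct Hv as [h | h].
    + exists ((a - x) / v1).
      change ((a, b) = (x + (a - x) / v1 * v1, y + (a - x) / v1 * v2)).
      f_equal; [field; assumption |].
      replace ((a - x) / v1 * v2) with (v2 * (a - x) / v1) by (field; assumption).
      rewrite <- E. field. assumption.
    + exists ((b - y) / v2).
      change ((a, b) = (x + (b - y) / v2 * v1, y + (b - y) / v2 * v2)).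
      f_equal; [| field; assumption].
      replace ((b - y) / v2 * v1) with (v1 * (b - y) / v2) by (field; assumption).
      rewrite E. field. assumption.
Qed.

Lemma line_origin (x y v1 v2 : R) : line (x, y) (v1, v2) (x, y).
Proof. exists 0. change ((x, y) = (x + 0 * v1, y + 0 * v2)). f_equal; ring. Qed.

Lemma line_through_eq (x y a b : R) :
  line_through (x, y) (a, b) = line (x, y) (a - x, b - y).
Proof. reflexivity. Qed.

Lemma line_same (x y v1 v2 a b w1 w2 : R) :
  v1 <> 0 \/ v2 <> 0 -> w1 <> 0 \/ w2 <> 0 -> v1 * w2 = v2 * w1 ->
  v1 * (b - y) = v2 * (a - x) -> same (line (x, y) (v1, v2)) (line (a, b) (w1, w2)).
Proof.
  intros Hv Hw E E'.
  assert (H : forall p q : R,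
            line (x, y) (v1, v2) (p, q) <-> line (a, b) (w1, w2) (p, q)).
  { intros p q. rewrite !line_iff by assumption. split; intros K.
    - destruct Hv; [apply Rmult_eq_reg_l with v1 | apply Rmult_eq_reg_l with v2];
        try assumption; nsatz.
    - destruct Hw; [apply Rmult_eq_reg_l with w1 | apply Rmult_eq_reg_l with w2];
        try assumption; nsatz. }
  intros [p q]. apply H.
Qed.

Lemma line_direction (x y v1 v2 a b w1 w2 : R) :
  v1 <> 0 \/ v2 <> 0 -> same (line (x, y) (v1, v2)) (line (a, b) (w1, w2)) ->
  v1 * w2 = v2 * w1.
Proof.
  intros Hv H.
  pose proof (proj2 (H (a, b)) (line_origin a b w1 w2)) as K1.
  pose proof (proj2 (H (a + w1, b + w2)) ltac:(exists 1;
    change ((a + w1, b + w2) = (a + 1 * w1, b + 1 * w2)); f_equal; ring)) as K2.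
  rewrite line_iff in K1, K2 by assumption. lra.
Qed.

Lemma same_sym (S T : pset) : same S T -> same T S.
Proof. intros H P. now rewrite (H P). Qed.

Lemma same_trans (S T U : pset) : same S T -> same T U -> same S U.
Proof. intros H K P. now rewrite (H P). Qed.

Lemma normal_at_iff (C : pset) (X : plane) (N : pset) (F Fx Fy : plane -> R) :
  C X -> regular_equation C X F Fx Fy ->
  (normal_at C X N <-> same N (line X (Fx X, Fy X))).
Proof.
  intros HX HF. split.
  - intros (_ & G & Gx & Gy & HG & HN). apply same_trans with (1 := HN).
    pose proof (gradient_unique C X F Fx Fy G Gx Gy HX HF HG) as E.
    destruct HF as [_ HF], HG as [_ HG]. destruct X as [a b].
    apply line_same; try assumption; lra.
  - intros HN. split; [assumption |]. exists F, Fx, Fy. auto.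
Qed.

Lemma continuous_plane (f : R -> R -> R) (x y : R) :
  continuity_2d_pt f x y ->
  continuous (fun P : plane => f (fst P) (snd P)) (x, y).
Proof. intros H. exact (proj1 (continuity_2d_pt_filterlim f x y) H). Qed.

Lemma circle_regular (o1 o2 r x y : R) : 0 < r -> circle (o1, o2) r (x, y) ->
  regular_equation (circle (o1, o2) r) (x, y)
    (fun P => (fst P - o1) ^ 2 + (snd P - o2) ^ 2 - r ^ 2)
    (fun P => 2 * (fst P - o1)) (fun P => 2 * (snd P - o2)).
Proof.
  intros Hr HX. split.
  - apply filter_forall. intros [u v]. change R in u, v. cbn [fst snd].
    split; [split | split; [| split; [| split]]].
    + unfold circle. rewrite norm_minus. intros E.
      rewrite <- (dist2_sqr u v o1 o2), E. ring.
    + unfold circle. rewrite norm_minus. intros E. apply dist2_eq; lra.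
    + auto_derive; [exact I | ring].
    + auto_derive; [exact I | ring].
    + apply (continuous_plane (fun x _ => 2 * (x - o1))).
      apply continuity_2d_pt_mult; [apply continuity_2d_pt_const |].
      apply continuity_2d_pt_minus;
        [apply continuity_2d_pt_id1 | apply continuity_2d_pt_const].
    + apply (continuous_plane (fun _ y => 2 * (y - o2))).
      apply continuity_2d_pt_mult; [apply continuity_2d_pt_const |].
      apply continuity_2d_pt_minus;
        [apply continuity_2d_pt_id2 | apply continuity_2d_pt_const].
  - unfold circle in HX. rewrite norm_minus in HX. cbn [fst snd].
    pose proof (dist2_sqr x y o1 o2) as E. rewrite HX in E.
    destruct (Req_dec (x - o1) 0) as [e |]; [right | left; lra].
    intro e2. rewrite e in E. nra.
Qed.

(** * Regular equations of Cartesian ovals *)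

Lemma dist2_continuous (a b x y : R) : continuity_2d_pt (dist2 a b) x y.
Proof.
  apply (continuity_1d_2d_pt_comp sqrt (fun x y => (a - x) ^ 2 + (b - y) ^ 2)).
  - apply continuity_pt_filterlim. apply (continuous_sqrt _).
  - assert (H1 : continuity_2d_pt (fun x _ : R => a - x) x y)
      by (apply continuity_2d_pt_minus;
          [apply continuity_2d_pt_const | apply continuity_2d_pt_id1]).
    assert (H2 : continuity_2d_pt (fun _ y : R => b - y) x y)
      by (apply continuity_2d_pt_minus;
          [apply continuity_2d_pt_const | apply continuity_2d_pt_id2]).
    apply continuity_2d_pt_plus.
    + apply (continuity_2d_pt_ext (fun x y : R => (a - x) * (a - x)));
        [intros; ring |]. now apply continuity_2d_pt_mult.
    + apply (continuity_2d_pt_ext (fun x y : R => (b - y) * (b - y)));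
        [intros; ring |]. now apply continuity_2d_pt_mult.
Qed.

Definition oval_grad_x (a1 a2 b1 b2 s : R) (P : plane) : R :=
  (fst P - a1) / dist2 a1 a2 (fst P) (snd P) +
  s * ((fst P - b1) / dist2 b1 b2 (fst P) (snd P)).

Definition oval_grad_y (a1 a2 b1 b2 s : R) (P : plane) : R :=
  (snd P - a2) / dist2 a1 a2 (fst P) (snd P) +
  s * ((snd P - b2) / dist2 b1 b2 (fst P) (snd P)).

(** The gradient is a unit vector plus [s] times a unit vector, so it can vanish only if
    [Rabs s = 1]. *)
Lemma oval_grad_neq0 (a1 a2 b1 b2 s x y : R) : Rabs s <> 1 ->
  (x, y) <> (a1, a2) -> (x, y) <> (b1, b2) ->
  oval_grad_x a1 a2 b1 b2 s (x, y) <> 0 \/ oval_grad_y a1 a2 b1 b2 s (x, y) <> 0.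
Proof.
  intros Hs HA HB.
  assert (HA' := dist2_pos a1 a2 x y ltac:(congruence)).
  assert (HB' := dist2_pos b1 b2 x y ltac:(congruence)).
  pose proof (dist2_sqr a1 a2 x y) as EA. pose proof (dist2_sqr b1 b2 x y) as EB.
  unfold oval_grad_x, oval_grad_y. cbn [fst snd].
  set (u := dist2 a1 a2 x y) in *. set (v := dist2 b1 b2 x y) in *.
  assert (NA : ((x - a1) / u) ^ 2 + ((y - a2) / u) ^ 2 = 1).
  { transitivity (((a1 - x) ^ 2 + (a2 - y) ^ 2) / u ^ 2); [field; lra |].
    rewrite <- EA. field; lra. }
  assert (NB : ((x - b1) / v) ^ 2 + ((y - b2) / v) ^ 2 = 1).
  { transitivity (((b1 - x) ^ 2 + (b2 - y) ^ 2) / v ^ 2); [field; lra |].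
    rewrite <- EB. field; lra. }
  set (p := (x - a1) / u) in *. set (q := (y - a2) / u) in *.
  set (p' := (x - b1) / v) in *. set (q' := (y - b2) / v) in *.
  assert (Hs2 : s ^ 2 <> 1).
  { intro E. apply Hs. destruct (Rcase_abs s) as [h | h];
      [rewrite Rabs_left | rewrite Rabs_right]; nra. }
  destruct (Req_dec (p + s * p') 0) as [e1 | e1]; [right | now left].
  intro e2. apply Hs2.
  replace p with (- s * p') in NA by lra. replace q with (- s * q') in NA by lra.
  replace (s ^ 2) with (s ^ 2 * (p' ^ 2 + q' ^ 2)) by (rewrite NB; ring). lra.
Qed.

Lemma oval_locally_off (a1 a2 b1 b2 s t x y : R) :
  ~ cartesian_oval (a1, a2) (b1, b2) s t (x, y) ->
  locally (x, y) (fun Q : plane => ~ cartesian_oval (a1, a2) (b1, b2) s t Q).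
Proof.
  intros H.
  assert (K : locally_2d (fun u v => dist2 a1 a2 u v + s * dist2 b1 b2 u v - t <> 0) x y).
  { apply continuity_2d_pt_neq_0.
    - apply continuity_2d_pt_minus; [| apply continuity_2d_pt_const].
      apply continuity_2d_pt_plus; [apply dist2_continuous |].
      apply continuity_2d_pt_mult; [apply continuity_2d_pt_const | apply dist2_continuous].
    - unfold cartesian_oval in H. rewrite !norm_minus in H. lra. }
  apply locally_2d_locally in K.
  apply filter_imp with (2 := K). intros [u v] h.
  unfold cartesian_oval. rewrite !norm_minus. cbn [fst snd] in h. lra.
Qed.

Lemma oval_regular (a1 a2 b1 b2 s t x y : R) : Rabs s <> 1 ->
  (x, y) <> (a1, a2) -> (x, y) <> (b1, b2) ->
  regular_equation (cartesian_oval (a1, a2) (b1, b2) s t) (x, y)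
    (fun P => dist2 a1 a2 (fst P) (snd P) + s * dist2 b1 b2 (fst P) (snd P) - t)
    (oval_grad_x a1 a2 b1 b2 s) (oval_grad_y a1 a2 b1 b2 s).
Proof.
  intros Hs HA HB. split; [| now apply oval_grad_neq0].
  assert (KA := dist2_pos a1 a2 x y ltac:(congruence)).
  assert (KB := dist2_pos b1 b2 x y ltac:(congruence)).
  assert (LA : locally_2d (fun u v => dist2 a1 a2 u v <> 0) x y)
    by (apply continuity_2d_pt_neq_0; [apply dist2_continuous | lra]).
  assert (LB : locally_2d (fun u v => dist2 b1 b2 u v <> 0) x y)
    by (apply continuity_2d_pt_neq_0; [apply dist2_continuous | lra]).
  apply locally_2d_locally in LA, LB.
  apply filter_imp with (2 := filter_and _ _ LA LB).
  intros [u v]. change R in u, v. cbn [fst snd]. intros [NA NB].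
  assert (PA : 0 < (a1 - u) ^ 2 + (a2 - v) ^ 2)
    by (rewrite <- dist2_sqr; pose proof (dist2_nonneg a1 a2 u v); nra).
  assert (PB : 0 < (b1 - u) ^ 2 + (b2 - v) ^ 2)
    by (rewrite <- dist2_sqr; pose proof (dist2_nonneg b1 b2 u v); nra).
  assert (Cg : forall c d (g : R -> R -> R), dist2 c d u v <> 0 ->
            continuity_2d_pt g u v ->
            continuity_2d_pt (fun u v => g u v / dist2 c d u v) u v).
  { intros c d g Hcd Hg. apply continuity_2d_pt_mult; [assumption |].
    apply continuity_2d_pt_inv; [apply dist2_continuous | assumption]. }
  assert (C1 : forall c, continuity_2d_pt (fun u _ : R => u - c) u v)
    by (intro c; apply continuity_2d_pt_minus;
        [apply continuity_2d_pt_id1 | apply continuity_2d_pt_const]).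
  assert (C2 : forall c, continuity_2d_pt (fun _ v : R => v - c) u v)
    by (intro c; apply continuity_2d_pt_minus;
        [apply continuity_2d_pt_id2 | apply continuity_2d_pt_const]).
  split; [split | split; [| split; [| split]]].
  - unfold cartesian_oval. rewrite !norm_minus. intros. lra.
  - unfold cartesian_oval. rewrite !norm_minus. intros. lra.
  - unfold oval_grad_x, dist2 in *; cbn [fst snd] in *.
    auto_derive; [repeat split; lra |].
    change (- (1) * ((1 + 1) * ((a1 - u) * 1)) * / (2 * sqrt ((a1 - u) ^ 2 + (a2 - v) ^ 2)) +
      s * (- (1) * ((1 + 1) * ((b1 - u) * 1)) * / (2 * sqrt ((b1 - u) ^ 2 + (b2 - v) ^ 2))) =
      (u - a1) / sqrt ((a1 - u) ^ 2 + (a2 - v) ^ 2) +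
      s * ((u - b1) / sqrt ((b1 - u) ^ 2 + (b2 - v) ^ 2))).
    field; split; assumption.
  - unfold oval_grad_y, dist2 in *; cbn [fst snd] in *.
    auto_derive; [repeat split; lra |].
    change (- (1) * ((1 + 1) * ((a2 - v) * 1)) * / (2 * sqrt ((a1 - u) ^ 2 + (a2 - v) ^ 2)) +
      s * (- (1) * ((1 + 1) * ((b2 - v) * 1)) * / (2 * sqrt ((b1 - u) ^ 2 + (b2 - v) ^ 2))) =
      (v - a2) / sqrt ((a1 - u) ^ 2 + (a2 - v) ^ 2) +
      s * ((v - b2) / sqrt ((b1 - u) ^ 2 + (b2 - v) ^ 2))).
    field; split; assumption.
  - apply (continuous_plane (fun x y => (x - a1) / dist2 a1 a2 x y +
      s * ((x - b1) / dist2 b1 b2 x y))).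
    apply continuity_2d_pt_plus; [now apply Cg |].
    apply continuity_2d_pt_mult; [apply continuity_2d_pt_const | now apply Cg].
  - apply (continuous_plane (fun x y => (y - a2) / dist2 a1 a2 x y +
      s * ((y - b2) / dist2 b1 b2 x y))).
    apply continuity_2d_pt_plus; [now apply Cg |].
    apply continuity_2d_pt_mult; [apply continuity_2d_pt_const | now apply Cg].
Qed.

(** * Ovals passing through a focus *)

Lemma dist2_sym (x y a b : R) : dist2 x y a b = dist2 a b x y.
Proof. unfold dist2. f_equal. ring. Qed.

Lemma dist2_triangle (a1 a2 b1 b2 x y : R) :
  dist2 a1 a2 b1 b2 <= dist2 a1 a2 x y + dist2 x y b1 b2.
Proof.
  rewrite <- !norm_minus.
  replace (minus (a1, a2) (b1, b2) : plane)
    with (plus (minus (a1, a2) (x, y)) (minus (x, y) (b1, b2)) : plane).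
  - exact (@norm_triangle R_AbsRing plane (minus (a1, a2) (x, y)) (minus (x, y) (b1, b2))).
  - change ((a1 + - x + (x + - b1), a2 + - y + (y + - b2)) = (a1 + - b1, a2 + - b2)).
    f_equal; ring.
Qed.

(** A point [M] of this oval satisfies [|AM| = |s| ||AB| - |BM||], which is at most [|s| |AM|] by
    the triangle inequality. For [|s| < 1] only the focus [A] remains. *)
Lemma focal_oval_real (a1 a2 b1 b2 s : R) :
  is_real_curve (cartesian_oval (a1, a2) (b1, b2) s (s * dist2 a1 a2 b1 b2)) ->
  1 <= Rabs s.
Proof.
  intros (P & Q & HP & HQ & HPQ).
  assert (K : forall x y, (x, y) <> (a1, a2) ->
    cartesian_oval (a1, a2) (b1, b2) s (s * dist2 a1 a2 b1 b2) (x, y) -> 1 <= Rabs s).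
  { intros x y Hne H. unfold cartesian_oval in H. rewrite !norm_minus in H.
    assert (Hp := dist2_pos a1 a2 x y ltac:(congruence)).
    pose proof (dist2_triangle a1 a2 b1 b2 x y) as T1.
    pose proof (dist2_triangle b1 b2 x y a1 a2) as T2.
    rewrite (dist2_sym x y b1 b2) in T1. rewrite (dist2_sym b1 b2 a1 a2) in T2.
    set (u := dist2 a1 a2 x y) in *. set (v := dist2 b1 b2 x y) in *.
    set (d := dist2 a1 a2 b1 b2) in *.
    assert (E : u = Rabs s * Rabs (d - v)).
    { rewrite <- Rabs_mult, <- (Rabs_pos_eq u) by lra. f_equal. lra. }
    assert (Rabs (d - v) <= u) by (apply Rabs_le; lra).
    pose proof (Rabs_pos (d - v)). pose proof (Rabs_pos s). nra. }
  destruct P as [x y], Q as [x' y'].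
  destruct (Req_dec x a1) as [E1 |]; [destruct (Req_dec y a2) as [E2 |] |].
  - apply (K x' y'); [congruence | assumption].
  - apply (K x y); [congruence | assumption].
  - apply (K x y); [congruence | assumption].
Qed.

(* If [t = s |AB|] the oval passes through its focus [A] along two branches
   tangent to the directions of angle [+-acos (1 / s)] with [AB]. *)
Lemma focal_oval_not_regular (D : pset) (a1 a2 b1 b2 s : R) (F Fx Fy : plane -> R) :
  (a1, a2) <> (b1, b2) -> Rabs s <> 1 ->
  is_real_curve (cartesian_oval (a1, a2) (b1, b2) s (s * dist2 a1 a2 b1 b2)) ->
  (forall P, cartesian_oval (a1, a2) (b1, b2) s (s * dist2 a1 a2 b1 b2) P -> D P) ->
  ~ regular_equation D (a1, a2) F Fx Fy.
Proof.
  intros Hab Hs Hreal HD HF.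
  assert (Hs1 : 1 < Rabs s) by (apply focal_oval_real in Hreal; lra).
  assert (Hs0 : s <> 0) by (intro E; rewrite E, Rabs_R0 in Hs1; lra).
  assert (Hd := dist2_pos a1 a2 b1 b2 Hab).
  pose proof (dist2_sqr a1 a2 b1 b2) as Ed.
  set (d := dist2 a1 a2 b1 b2) in *.
  set (i := / s).
  assert (Hi : - 1 < i < 1).
  { assert (K : Rabs i < 1).
    { unfold i. rewrite Rabs_inv. rewrite <- Rinv_1.
      apply Rinv_lt_contravar; lra. }
    apply Rabs_def2 in K. lra. }
  assert (Hi0 : i <> 0) by now apply Rinv_neq_0_compat.
  set (e1 := (b1 - a1) / d). set (e2 := (b2 - a2) / d).
  assert (Ee : e1 ^ 2 + e2 ^ 2 = 1).
  { unfold e1, e2. transitivity (((a1 - b1) ^ 2 + (a2 - b2) ^ 2) / d ^ 2);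
      [field; lra |]. rewrite <- Ed. field; lra. }
  assert (B1 : b1 = a1 + d * e1) by (unfold e1; field; lra).
  assert (B2 : b2 = a2 + d * e2) by (unfold e2; field; lra).
  (* The law of cosines gives this as the cosine of the angle at [A] in the triangle with [|AM| = h]
     and [|BM| = d - h / s], that is, for the point of the oval at distance [h] from [A]. *)
  set (c := fun h => i + h * ((1 - i ^ 2) / (2 * d))).
  assert (Hc : forall h, 0 < h < d -> 0 <= 1 - c h ^ 2).
  { intros h Hh.
    assert (Hy : 0 <= h * ((1 - i ^ 2) / (2 * d)) <= (1 - i ^ 2) / 2).
    { replace (h * ((1 - i ^ 2) / (2 * d))) with ((h / d) * ((1 - i ^ 2) / 2))
        by (field; lra).
      assert (0 < h / d) by (apply Rdiv_lt_0_compat; lra).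
      assert (h / d <= 1) by (apply Rle_div_l; lra).
      assert (0 < (1 - i ^ 2) / 2) by nra. split; nra. }
    unfold c. set (y := h * ((1 - i ^ 2) / (2 * d))) in *.
    assert (0 <= 1 - (i + y)) by nra. assert (0 <= 1 + (i + y)) by lra. nra. }
  set (q := fun h => sqrt (1 - c h ^ 2)).
  assert (Hq : forall h, 0 < h < d -> q h ^ 2 = 1 - c h ^ 2)
    by (intros h Hh; apply pow2_sqrt; auto).
  assert (Cc : continuity_pt c 0) by (unfold c; reg).
  assert (Cq : continuity_pt q 0).
  { apply (continuity_pt_comp (fun h => 1 - c h ^ 2) sqrt); [unfold c; reg |].
    apply continuity_pt_filterlim. apply (continuous_sqrt _). }
  assert (HA : D (a1, a2)).
  { apply HD. unfold cartesian_oval. rewrite !norm_minus.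
    rewrite (dist2_eq a1 a2 a1 a2 0), (dist2_sym b1 b2); [| lra | ring].
    fold d. ring. }
  (* [j = 1] and [j = -1] select the two branches, mirror images in the line [AB]. *)
  assert (HO : forall j, j ^ 2 = 1 ->
    Fx (a1, a2) * (c 0 * e1 - j * q 0 * e2) + Fy (a1, a2) * (c 0 * e2 + j * q 0 * e1) = 0).
  { intros j Hj. apply (contingent_orthogonal D (a1, a2) F Fx Fy); try assumption.
    apply (contingent_curve D (a1, a2) (fun h => c h * e1 - j * q h * e2)
             (fun h => c h * e2 + j * q h * e1) d); [assumption | | |].
    - apply continuity_pt_minus; apply continuity_pt_mult;
        try apply continuity_pt_mult; try assumption; now apply continuity_pt_const.
    - apply continuity_pt_plus; apply continuity_pt_mult;
        try apply continuity_pt_mult; try assumption; now apply continuity_pt_const.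
    - intros h Hh. apply HD. unfold cartesian_oval. cbn [fst snd]. rewrite !norm_minus.
      specialize (Hq h Hh).
      rewrite (dist2_eq a1 a2 _ _ h); [rewrite (dist2_eq b1 b2 _ _ (d - h * i)) | |].
      + unfold i. field. assumption.
      + nra.
      + rewrite B1, B2.
        transitivity (d ^ 2 * (e1 ^ 2 + e2 ^ 2) - 2 * d * h * c h * (e1 ^ 2 + e2 ^ 2) +
          h ^ 2 * (c h ^ 2 + j ^ 2 * q h ^ 2) * (e1 ^ 2 + e2 ^ 2)); [| ring].
        rewrite Ee, Hj, Hq. unfold c. field. lra.
      + lra.
      + transitivity (h ^ 2 * (c h ^ 2 + j ^ 2 * q h ^ 2) * (e1 ^ 2 + e2 ^ 2)); [| ring].
        rewrite Ee, Hj, Hq. ring. }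
  (* Sum and difference of the two relations make the gradient orthogonal to [AB] and to its
     perpendicular, since neither [c 0] nor [q 0] vanishes. *)
  pose proof (HO 1 ltac:(ring)) as O1. pose proof (HO (-1) ltac:(ring)) as O2.
  assert (C0 : c 0 = i) by (unfold c; ring).
  assert (Q0 : q 0 <> 0).
  { unfold q. rewrite C0. apply Rgt_not_eq, sqrt_lt_R0. nra. }
  destruct HF as [_ HF].
  set (p := Fx (a1, a2)) in *. set (p' := Fy (a1, a2)) in *.
  assert (K1 : p * e1 + p' * e2 = 0).
  { apply (Rmult_eq_reg_l (c 0)); [lra | now rewrite C0]. }
  assert (K2 : p' * e1 - p * e2 = 0).
  { apply (Rmult_eq_reg_l (q 0)); [lra | assumption]. }
  assert (p = 0).
  { transitivity (e1 * (p * e1 + p' * e2) - e2 * (p' * e1 - p * e2) +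
      p * (1 - (e1 ^ 2 + e2 ^ 2))); [ring | rewrite K1, K2, Ee; ring]. }
  assert (p' = 0).
  { transitivity (e2 * (p * e1 + p' * e2) + e1 * (p' * e1 - p * e2) +
      p' * (1 - (e1 ^ 2 + e2 ^ 2))); [ring | rewrite K1, K2, Ee; ring]. }
  tauto.
Qed.

(** * Normals to the union of the ovals *)

Lemma real_curve_ext (C D : pset) : same C D -> is_real_curve C -> is_real_curve D.
Proof.
  intros E (P & Q & HP & HQ & HPQ). apply E in HP, HQ. now exists P, Q.
Qed.

Lemma locally_mono (X : plane) (P Q : pset) :
  (forall Y, P Y -> Q Y) -> locally X P -> locally X Q.
Proof. apply filter_imp. Qed.

Lemma locally_and (X : plane) (P Q : pset) :
  locally X P -> locally X Q -> locally X (fun Y => P Y /\ Q Y).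
Proof. apply filter_and. Qed.

Lemma regular_equation_ext (C D : pset) (X : plane) (F Fx Fy : plane -> R) :
  locally X (fun Q => C Q <-> D Q) ->
  regular_equation C X F Fx Fy -> regular_equation D X F Fx Fy.
Proof.
  intros HCD [H Hnz]. split; [| assumption].
  apply filter_imp with (2 := filter_and _ _ HCD H).
  intros Q [E K]. rewrite <- E. exact K.
Qed.

(** [D] may be larger than the oval, so that the lemma covers the union as well: further points
    cannot remove the two branches. *)
Lemma regular_not_focus (D : pset) (a1 a2 b1 b2 s t x y : R) (F Fx Fy : plane -> R) :
  (a1, a2) <> (b1, b2) -> s <> 0 -> Rabs s <> 1 ->
  is_real_curve (cartesian_oval (a1, a2) (b1, b2) s t) ->
  (forall P, cartesian_oval (a1, a2) (b1, b2) s t P -> D P) ->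
  cartesian_oval (a1, a2) (b1, b2) s t (x, y) -> regular_equation D (x, y) F Fx Fy ->
  (x, y) <> (a1, a2) /\ (x, y) <> (b1, b2).
Proof.
  intros Hab Hs0 Hs1 Hreal HD HM HF.
  unfold cartesian_oval in HM. rewrite !norm_minus in HM.
  split; intro E; injection E as -> ->.
  - rewrite (dist2_eq a1 a2 a1 a2 0), (dist2_sym b1 b2) in HM; [| lra | ring].
    rewrite Rplus_0_l in HM. subst t.
    exact (focal_oval_not_regular D a1 a2 b1 b2 s F Fx Fy Hab Hs1 Hreal HD HF).
  - rewrite (dist2_eq b1 b2 b1 b2 0), Rmult_0_r, Rplus_0_r in HM; [| lra | ring].
    subst t.
    (* Dividing the equation by [s] exchanges the foci and replaces [s] by [/ s], which reduces the
       focus [B] to the focus [A]. *)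
    assert (E : forall P, cartesian_oval (a1, a2) (b1, b2) s (dist2 a1 a2 b1 b2) P <->
                cartesian_oval (b1, b2) (a1, a2) (/ s) (/ s * dist2 b1 b2 a1 a2) P).
    { intros P. unfold cartesian_oval. rewrite (dist2_sym b1 b2). split; intros K.
      - rewrite <- K. field. assumption.
      - apply (Rmult_eq_reg_l (/ s)); [| now apply Rinv_neq_0_compat].
        rewrite <- K. field. assumption. }
    apply (focal_oval_not_regular D b1 b2 a1 a2 (/ s) F Fx Fy).
    + congruence.
    + rewrite Rabs_inv. intro h. apply Hs1. rewrite <- (Rinv_inv (Rabs s)), h. apply Rinv_1.
    + exact (real_curve_ext _ _ E Hreal).
    + intros P HP. apply HD, E, HP.
    + exact HF.
Qed.

Lemma sign_sqr (sigma : R) : is_sign sigma -> sigma ^ 2 = 1.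
Proof. intros [-> | ->]; ring. Qed.

Lemma sign_Rabs (sigma s : R) : is_sign sigma -> Rabs (sigma * s) = Rabs s.
Proof.
  intros [-> | ->]; [| now rewrite Rmult_1_l].
  replace (-1 * s) with (- s) by ring. apply Rabs_Ropp.
Qed.

(** If exactly one sign differs, subtracting the equations gives [s * v = 0] or [t = 0]; if both
    differ, adding them gives [u = 0]. *)
Lemma ovals_meet_at_foci (u v s t sigma1 sigma2 tau1 tau2 : R) :
  is_sign sigma1 -> is_sign sigma2 -> is_sign tau1 -> is_sign tau2 ->
  0 < u -> 0 < v -> 0 < s -> 0 < t ->
  u + sigma1 * s * v = sigma2 * t -> u + tau1 * s * v = tau2 * t ->
  sigma1 = tau1 /\ sigma2 = tau2.
Proof.
  intros H1 H2 H3 H4 Hu Hv Hs Ht E E'.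
  assert (Hsv : 0 < s * v) by now apply Rmult_lt_0_compat.
  destruct H1 as [-> | ->], H2 as [-> | ->], H3 as [-> | ->], H4 as [-> | ->];
    split; lra.
Qed.

(** The other three ovals are closed and miss the point, so each stays away from a neighbourhood of
    it. *)
Lemma locally_union (a1 a2 b1 b2 a r n sigma1 sigma2 x y : R) :
  0 < a -> 0 < r -> n <> 0 -> (a1, a2) <> (b1, b2) ->
  is_sign sigma1 -> is_sign sigma2 -> (x, y) <> (a1, a2) -> (x, y) <> (b1, b2) ->
  oval (a1, a2) (b1, b2) a r n sigma1 sigma2 (x, y) ->
  is_real_curve (oval (a1, a2) (b1, b2) a r n sigma1 sigma2) ->
  locally (x, y) (fun Q : plane => real_ovals_union (a1, a2) (b1, b2) a r n Q <->
    oval (a1, a2) (b1, b2) a r n sigma1 sigma2 Q).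
Proof.
  intros Ha Hr Hn Hab S1 S2 HA HB HM Hreal.
  assert (Hd := dist2_pos a1 a2 b1 b2 Hab).
  assert (Hs : 0 < a / r) by now apply Rdiv_lt_0_compat.
  assert (Ht : 0 < a * dist2 a1 a2 b1 b2 / (r * Rabs n)).
  { apply Rdiv_lt_0_compat; apply Rmult_lt_0_compat; try assumption.
    now apply Rabs_pos_lt. }
  assert (Hu := dist2_pos a1 a2 x y ltac:(congruence)).
  assert (Hv := dist2_pos b1 b2 x y ltac:(congruence)).
  assert (Off : forall tau1 tau2, is_sign tau1 -> is_sign tau2 ->
    locally (x, y) (fun Q : plane => oval (a1, a2) (b1, b2) a r n tau1 tau2 Q ->
      tau1 = sigma1 /\ tau2 = sigma2)).
  { intros tau1 tau2 T1 T2.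
    destruct (Req_dec tau1 sigma1) as [E1 | N1];
      [destruct (Req_dec tau2 sigma2) as [E2 | N2] |].
    - apply filter_forall. auto.
    - apply locally_mono with (P := fun Q : plane => ~ oval (a1, a2) (b1, b2) a r n tau1 tau2 Q);
        [intros; contradiction |].
      apply oval_locally_off. intro K. apply N2.
      unfold oval, cartesian_oval in K, HM. rewrite !norm_minus in K, HM.
      apply (ovals_meet_at_foci _ _ _ _ _ _ _ _ T1 T2 S1 S2 Hu Hv Hs Ht K HM).
    - apply locally_mono with (P := fun Q : plane => ~ oval (a1, a2) (b1, b2) a r n tau1 tau2 Q);
        [intros; contradiction |].
      apply oval_locally_off. intro K. apply N1.
      unfold oval, cartesian_oval in K, HM. rewrite !norm_minus in K, HM.
      apply (ovals_meet_at_foci _ _ _ _ _ _ _ _ T1 T2 S1 S2 Hu Hv Hs Ht K HM). }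
  assert (P1 : is_sign 1) by now right. assert (P2 : is_sign (-1)) by now left.
  eapply locally_mono; [| exact (locally_and (x, y) _ _
    (locally_and (x, y) _ _ (Off _ _ P1 P1) (Off _ _ P1 P2))
    (locally_and (x, y) _ _ (Off _ _ P2 P1) (Off _ _ P2 P2)))].
  intros Q [[K1 K2] [K3 K4]]. split.
  - intros (C & (tau1 & tau2 & T1 & T2 & E & _) & HQ). apply E in HQ.
    assert (K : tau1 = sigma1 /\ tau2 = sigma2)
      by (destruct T1 as [-> | ->], T2 as [-> | ->]; auto).
    destruct K as [-> ->]. exact HQ.
  - intros HQ. exists (oval (a1, a2) (b1, b2) a r n sigma1 sigma2).
    split; [| exact HQ]. exists sigma1, sigma2. repeat split; auto.
Qed.

Lemma oval_slope (a r sigma : R) : 0 < a -> 0 < r -> a <> r -> is_sign sigma ->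
  sigma * (a / r) <> 0 /\ Rabs (sigma * (a / r)) <> 1.
Proof.
  intros Ha Hr Har Hs.
  assert (H : 0 < a / r) by now apply Rdiv_lt_0_compat.
  rewrite sign_Rabs, Rabs_pos_eq by (try assumption; lra).
  split.
  - destruct Hs as [-> | ->]; lra.
  - intro E. apply Har. replace a with (a / r * r) by (field; lra). rewrite E. ring.
Qed.

Lemma real_oval_regular_point (D C : pset) (a1 a2 b1 b2 a r n x y : R)
    (F Fx Fy : plane -> R) :
  0 < a -> 0 < r -> a <> r -> (a1, a2) <> (b1, b2) ->
  real_oval (a1, a2) (b1, b2) a r n C -> (forall P, C P -> D P) -> C (x, y) ->
  regular_equation D (x, y) F Fx Fy ->
  (x, y) <> (a1, a2) /\ (x, y) <> (b1, b2).
Proof.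
  intros Ha Hr Har Hab (sigma1 & sigma2 & S1 & S2 & E & Hreal) HD HM HF.
  destruct (oval_slope a r sigma1 Ha Hr Har S1) as [Hs0 Hs1].
  apply (regular_not_focus D a1 a2 b1 b2 _
           (sigma2 * (a * norm (minus (a1, a2) (b1, b2) : plane) / (r * Rabs n)))
           x y F Fx Fy Hab Hs0 Hs1).
  - exact (real_curve_ext _ _ E Hreal).
  - intros P HP. apply HD, E, HP.
  - apply E, HM.
  - exact HF.
Qed.

(** A regular point, of the union or of a single oval, is never a focus; elsewhere the two sets
    agree locally, so a regular equation of one is a regular equation of the other. *)
Lemma normals_union (a1 a2 b1 b2 a r n : R) (L : pset) :
  0 < a -> 0 < r -> n <> 0 -> a <> r -> (a1, a2) <> (b1, b2) ->
  (normals (real_ovals_union (a1, a2) (b1, b2) a r n) L <->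
   exists C, real_oval (a1, a2) (b1, b2) a r n C /\ normals C L).
Proof.
  intros Ha Hr Hn Har Hab.
  assert (Loc : forall C x y, real_oval (a1, a2) (b1, b2) a r n C -> C (x, y) ->
    (x, y) <> (a1, a2) -> (x, y) <> (b1, b2) ->
    locally (x, y) (fun Q : plane => real_ovals_union (a1, a2) (b1, b2) a r n Q <-> C Q)).
  { intros C x y (sigma1 & sigma2 & S1 & S2 & E & Hreal) HM HA HB.
    apply locally_mono with (P := fun Q : plane =>
      real_ovals_union (a1, a2) (b1, b2) a r n Q <->
      oval (a1, a2) (b1, b2) a r n sigma1 sigma2 Q).
    - intros Q K. rewrite (E Q). exact K.
    - apply locally_union; try assumption; [apply E, HM |].
      exact (real_curve_ext _ _ E Hreal). }
  split.
  - intros ([x y] & (C & HC & HM) & F & Fx & Fy & HF & HL).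
    exists C. split; [assumption |]. exists (x, y). split; [assumption |].
    exists F, Fx, Fy. split; [| assumption].
    destruct (real_oval_regular_point (real_ovals_union (a1, a2) (b1, b2) a r n) C
      a1 a2 b1 b2 a r n x y F Fx Fy) as [HA HB]; try assumption.
    { intros P HP. now exists C. }
    exact (regular_equation_ext _ _ _ _ _ _ (Loc C x y HC HM HA HB) HF).
  - intros (C & HC & [x y] & HM & F & Fx & Fy & HF & HL).
    exists (x, y). split; [now exists C |].
    exists F, Fx, Fy. split; [| assumption].
    destruct (real_oval_regular_point C C a1 a2 b1 b2 a r n x y F Fx Fy) as [HA HB];
      try assumption; [auto |].
    apply regular_equation_ext with (2 := HF).
    apply locally_mono with (2 := Loc C x y HC HM HA HB). intros Q K. now rewrite K.
Qed.

(** This removes both [is_real_curve] and the arbitrary equations, leaving a point off the foci and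
    an explicit gradient. *)
Lemma real_oval_normals (a1 a2 b1 b2 a r n : R) (L : pset) :
  0 < a -> 0 < r -> a <> r -> (a1, a2) <> (b1, b2) ->
  ((exists C, real_oval (a1, a2) (b1, b2) a r n C /\ normals C L) <->
   exists sigma1 sigma2 x y, is_sign sigma1 /\ is_sign sigma2 /\
     (x, y) <> (a1, a2) /\ (x, y) <> (b1, b2) /\
     oval (a1, a2) (b1, b2) a r n sigma1 sigma2 (x, y) /\
     same L (line (x, y) (oval_grad_x a1 a2 b1 b2 (sigma1 * (a / r)) (x, y),
                          oval_grad_y a1 a2 b1 b2 (sigma1 * (a / r)) (x, y)))).
Proof.
  intros Ha Hr Har Hab. split.
  - intros (C & HC & [x y] & HN). pose proof HN as (HM & F & Fx & Fy & HF & _).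
    destruct (real_oval_regular_point C C a1 a2 b1 b2 a r n x y F Fx Fy) as [HA HB];
      try assumption; [auto |].
    destruct HC as (sigma1 & sigma2 & S1 & S2 & E & _).
    exists sigma1, sigma2, x, y. repeat (split; [try assumption; now apply E |]).
    destruct (oval_slope a r sigma1 Ha Hr Har S1) as [_ Hs1].
    assert (HG := oval_regular a1 a2 b1 b2 (sigma1 * (a / r))
      (sigma2 * (a * norm (minus (a1, a2) (b1, b2) : plane) / (r * Rabs n)))
      x y Hs1 HA HB).
    apply regular_equation_ext with (D := C) in HG.
    + exact (proj1 (normal_at_iff C (x, y) L _ _ _ HM HG) HN).
    + apply filter_forall. intros Q. symmetry. apply E.
  - intros (sigma1 & sigma2 & x & y & S1 & S2 & HA & HB & HM & HL).
    destruct (oval_slope a r sigma1 Ha Hr Har S1) as [_ Hs1].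
    pose proof (oval_regular a1 a2 b1 b2 _
      (sigma2 * (a * norm (minus (a1, a2) (b1, b2) : plane) / (r * Rabs n)))
      x y Hs1 HA HB) as HF.
    exists (oval (a1, a2) (b1, b2) a r n sigma1 sigma2). split.
    + exists sigma1, sigma2. repeat split; try assumption; auto.
      exact (regular_not_isolated _ _ _ _ _ HM HF).
    + exists (x, y). apply (normal_at_iff _ _ _ _ _ _ HM HF). exact HL.
Qed.

(** * Snell's law *)

Lemma rotation_coord (x y theta q1 q2 : R) :
  rotation (x, y) theta (q1, q2) =
    (x + (cos theta * (q1 - x) - sin theta * (q2 - y)),
     y + (sin theta * (q1 - x) + cos theta * (q2 - y))).
Proof. reflexivity. Qed.

Lemma line_angle_iff (x y u1 u2 theta : R) (L0 L1 : pset) :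
  same L0 (line (x, y) (u1, u2)) ->
  (line_angle (x, y) L0 L1 theta <->
   - PI / 2 < theta <= PI / 2 /\
   same L1 (line (x, y) (cos theta * u1 - sin theta * u2,
                         sin theta * u1 + cos theta * u2))).
Proof.
  intros H.
  assert (E : same (fun P => exists Q, L0 Q /\ P = rotation (x, y) theta Q)
    (line (x, y) (cos theta * u1 - sin theta * u2, sin theta * u1 + cos theta * u2))).
  { intros P. split.
    - intros (Q & HQ & ->). apply H in HQ. destruct HQ as [k ->]. exists k.
      change (rotation (x, y) theta (x + k * u1, y + k * u2) =
        (x + k * (cos theta * u1 - sin theta * u2),
         y + k * (sin theta * u1 + cos theta * u2))).
      rewrite rotation_coord. f_equal; ring.
    - intros [k ->]. exists (x + k * u1, y + k * u2). split.
      + apply H. exists k. reflexivity.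
      + change ((x + k * (cos theta * u1 - sin theta * u2),
                 y + k * (sin theta * u1 + cos theta * u2)) =
          rotation (x, y) theta (x + k * u1, y + k * u2)).
        rewrite rotation_coord. f_equal; ring. }
  unfold line_angle. split; intros [Ht K]; split; try assumption.
  - apply same_trans with (1 := K). exact E.
  - apply same_trans with (1 := K). now apply same_sym.
Qed.

Lemma cos_sin_sqr (theta : R) : cos theta ^ 2 = 1 - sin theta ^ 2.
Proof. pose proof (sin2_cos2 theta). unfold Rsqr in *. lra. Qed.

Lemma angle_exists (y z : R) : exists theta,
  - PI / 2 < theta <= PI / 2 /\ cos theta * y = sin theta * z.
Proof.
  pose proof PI_RGT_0.
  destruct (Req_dec z 0) as [-> | Hz].
  - exists (PI / 2). rewrite cos_PI2, sin_PI2. lra.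
  - exists (atan (y / z)). pose proof (atan_bound (y / z)) as B. split; [lra |].
    assert (Hc : 0 < cos (atan (y / z))) by (apply cos_gt_0; lra).
    pose proof (tan_atan (y / z)) as T. unfold tan in T.
    apply (Rmult_eq_reg_r (/ cos (atan (y / z)) / z));
      [| apply Rmult_integral_contrapositive; split; apply Rinv_neq_0_compat; lra].
    transitivity (y / z); [field; lra |]. rewrite <- T at 1. field; lra.
Qed.

Lemma sin_eq_0_angle (theta : R) :
  - PI / 2 < theta <= PI / 2 -> sin theta = 0 -> theta = 0.
Proof.
  intros Ht Hs. pose proof PI_RGT_0.
  destruct (Rtotal_order theta 0) as [h | [h | h]]; [| assumption |].
  - pose proof (sin_lt_0_var theta ltac:(lra) h). lra.
  - pose proof (sin_gt_0 theta h ltac:(lra)). lra.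
Qed.

(** The hypothesis says that the angle from [p] to [w] has sine and cosine proportional to [s] and
    [c]; the squared conclusion is insensitive to the orientation of both vectors. Adding [s^2]
    times the squared cross product to the squared hypothesis leaves Lagrange's identity. *)
Lemma cross_angle (c s p1 p2 w1 w2 : R) : c ^ 2 = 1 - s ^ 2 ->
  c * (p1 * w2 - p2 * w1) = s * (p1 * w1 + p2 * w2) ->
  (p1 * w2 - p2 * w1) ^ 2 = s ^ 2 * (p1 ^ 2 + p2 ^ 2) * (w1 ^ 2 + w2 ^ 2).
Proof.
  intros Hc H.
  transitivity ((c * (p1 * w2 - p2 * w1)) ^ 2 + s ^ 2 * (p1 * w2 - p2 * w1) ^ 2).
  - replace ((c * (p1 * w2 - p2 * w1)) ^ 2)
      with (c ^ 2 * (p1 * w2 - p2 * w1) ^ 2) by ring. rewrite Hc. ring.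
  - rewrite H. ring.
Qed.

Lemma circle_normal (o1 o2 r x y : R) (N : pset) :
  0 < r -> circle (o1, o2) r (x, y) ->
  (normal_at (circle (o1, o2) r) (x, y) N <-> same N (line (x, y) (x - o1, y - o2))).
Proof.
  intros Hr HX.
  pose proof (circle_regular o1 o2 r x y Hr HX) as HF.
  rewrite (normal_at_iff _ _ N _ _ _ HX HF). cbn [fst snd].
  destruct HF as [_ HF]. cbn [fst snd] in HF.
  assert (E : same (line (x, y) (2 * (x - o1), 2 * (y - o2)))
                   (line (x, y) (x - o1, y - o2)))
    by (apply line_same; try assumption; try (destruct HF; [left | right]; lra); ring).
  split; intros K; apply same_trans with (1 := K); [exact E | now apply same_sym].
Qed.

Lemma circle_sqr (o1 o2 r x y : R) : circle (o1, o2) r (x, y) ->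
  (x - o1) ^ 2 + (y - o2) ^ 2 = r ^ 2.
Proof.
  unfold circle. rewrite norm_minus. intros <-. symmetry. apply dist2_sqr.
Qed.

Lemma circle_intro (o1 o2 r x y : R) :
  0 < r -> (x - o1) ^ 2 + (y - o2) ^ 2 = r ^ 2 -> circle (o1, o2) r (x, y).
Proof.
  intros Hr E. unfold circle. rewrite norm_minus. apply dist2_eq; lra.
Qed.

Lemma pair_neq (x y a b : R) : (x, y) <> (a, b) -> a - x <> 0 \/ b - y <> 0.
Proof.
  intros H. destruct (Req_dec (a - x) 0); [right | now left].
  intro. apply H. f_equal; lra.
Qed.

(* Snell's law up to sign, as an equation between squared sines. *)
Lemma refracted_ray_snell (o1 o2 r a1 a2 n x y : R) (L : pset) : 0 < r ->
  refracted_ray (a1, a2) (circle (o1, o2) r) n (x, y) L ->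
  circle (o1, o2) r (x, y) /\ exists v1 v2, v1 ^ 2 + v2 ^ 2 = 1 /\
    same L (line (x, y) (v1, v2)) /\
    ((x - o1) * (a2 - y) - (y - o2) * (a1 - x)) ^ 2 =
    n ^ 2 * ((x - o1) * v2 - (y - o2) * v1) ^ 2 * ((a1 - x) ^ 2 + (a2 - y) ^ 2).
Proof.
  intros Hr (HXA & N & ti & to & HN & Hin & _ & Hout & Hsin & _).
  assert (HX : circle (o1, o2) r (x, y)) by apply HN.
  split; [assumption |].
  apply circle_normal in HN; try assumption.
  apply (line_angle_iff _ _ _ _ _ _ _ HN) in Hin, Hout.
  destruct Hin as [_ Hin]. destruct Hout as [_ Hout].
  apply circle_sqr in HX.
  set (p1 := x - o1) in *. set (p2 := y - o2) in *.
  pose proof (cos_sin_sqr ti) as Ei. pose proof (cos_sin_sqr to) as Eo.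
  set (c := cos ti) in *. set (s := sin ti) in *.
  set (c' := cos to) in *. set (s' := sin to) in *.
  assert (Nout : ((c' * p1 - s' * p2) / r) ^ 2 + ((s' * p1 + c' * p2) / r) ^ 2 = 1).
  { transitivity ((c' ^ 2 + s' ^ 2) * (p1 ^ 2 + p2 ^ 2) / r ^ 2); [field; lra |].
    rewrite Eo, HX. field. lra. }
  exists ((c' * p1 - s' * p2) / r), ((s' * p1 + c' * p2) / r).
  split; [assumption |]. split.
  - apply same_trans with (1 := Hout).
    assert (K : c' * p1 - s' * p2 <> 0 \/ s' * p1 + c' * p2 <> 0).
    { destruct (Req_dec (c' * p1 - s' * p2) 0) as [e |]; [right | now left].
      intro e'. rewrite e, e' in Nout. unfold Rdiv in Nout. rewrite Rmult_0_l in Nout. lra. }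
    apply line_same; [assumption | | field; lra | ring].
    assert (Hir : / r <> 0) by (apply Rinv_neq_0_compat; lra).
    destruct K; [left | right]; now apply Rmult_integral_contrapositive.
  - rewrite line_through_eq in Hin.
    apply line_direction in Hin;
      [| apply pair_neq; congruence].
    rewrite (cross_angle c s p1 p2 (a1 - x) (a2 - y) Ei) by lra.
    replace (p1 * ((s' * p1 + c' * p2) / r) - p2 * ((c' * p1 - s' * p2) / r))
      with (s' * (p1 ^ 2 + p2 ^ 2) / r) by (field; lra).
    rewrite HX, Hsin. field. lra.
Qed.

(** The squared law factors into [sin ti = n * sin to] or [sin ti = - n * sin to], one for each of
    the two refraction constants. *)
Lemma snell_refracted (o1 o2 r a1 a2 n x y v1 v2 : R) (L : pset) :
  0 < r -> n <> 0 -> (x, y) <> (a1, a2) -> v1 <> 0 \/ v2 <> 0 ->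
  circle (o1, o2) r (x, y) -> same L (line (x, y) (v1, v2)) ->
  ((x - o1) * (a2 - y) - (y - o2) * (a1 - x)) ^ 2 * (v1 ^ 2 + v2 ^ 2) =
  n ^ 2 * ((x - o1) * v2 - (y - o2) * v1) ^ 2 * ((a1 - x) ^ 2 + (a2 - y) ^ 2) ->
  refracted_rays (a1, a2) (circle (o1, o2) r) n L.
Proof.
  intros Hr Hn HXA Hv HX HL E. exists (x, y).
  assert (HN := proj2 (circle_normal o1 o2 r x y _ Hr HX) (fun P => iff_refl _)).
  pose proof (circle_sqr _ _ _ _ _ HX) as HX2.
  set (p1 := x - o1) in *. set (p2 := y - o2) in *.
  assert (Hp : p1 <> 0 \/ p2 <> 0).
  { destruct (Req_dec p1 0) as [e |]; [right | now left].
    intro e'. rewrite e, e' in HX2. pose proof (pow_lt r 2 Hr). lra. }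
  assert (Hw := pair_neq _ _ _ _ HXA).
  (* Every direction is obtained from the normal by an angle in the admissible range; this is
     applied to the light ray and to [L]. *)
  assert (Rot : forall w1 w2, w1 <> 0 \/ w2 <> 0 -> exists theta,
    - PI / 2 < theta <= PI / 2 /\
    (p1 * w2 - p2 * w1) ^ 2 = sin theta ^ 2 * (p1 ^ 2 + p2 ^ 2) * (w1 ^ 2 + w2 ^ 2) /\
    same (line (x, y) (w1, w2))
      (line (x, y) (cos theta * p1 - sin theta * p2, sin theta * p1 + cos theta * p2))).
  { intros w1 w2 Hw12.
    destruct (angle_exists (p1 * w2 - p2 * w1) (p1 * w1 + p2 * w2)) as (th & Ht & Eth).
    exists th. split; [assumption |]. pose proof (cos_sin_sqr th) as Ec.
    split; [exact (cross_angle _ _ _ _ _ _ Ec Eth) |].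
    apply line_same; [assumption | | lra | ring].
    set (c := cos th) in *. set (s := sin th) in *.
    destruct (Req_dec (c * p1 - s * p2) 0) as [e |]; [right | now left].
    intro e'.
    assert (K : (c ^ 2 + s ^ 2) * (p1 ^ 2 + p2 ^ 2) = 0).
    { transitivity ((c * p1 - s * p2) ^ 2 + (s * p1 + c * p2) ^ 2); [ring |].
      rewrite e, e'. ring. }
    rewrite Ec, HX2 in K. pose proof (pow_lt r 2 Hr). lra. }
  destruct (Rot (a1 - x) (a2 - y) Hw) as (ti & Hti & Ei & Li).
  destruct (Rot v1 v2 Hv) as (to & Hto & Eo & Lo).
  assert (Li' : line_angle (x, y) (line (x, y) (p1, p2))
                  (line_through (a1, a2) (x, y)) ti).
  { apply (line_angle_iff x y p1 p2 _ _ _ (fun P => iff_refl _)). split; [assumption |].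
    apply same_trans with (2 := Li). rewrite line_through_eq.
    apply line_same; try assumption; try ring. destruct Hw; [left | right]; lra. }
  assert (Lo' : line_angle (x, y) (line (x, y) (p1, p2)) L to).
  { apply (line_angle_iff x y p1 p2 _ _ _ (fun P => iff_refl _)). split; [assumption |].
    exact (same_trans _ _ _ HL Lo). }
  assert (Es : sin ti ^ 2 = n ^ 2 * sin to ^ 2).
  { rewrite Ei, Eo, HX2 in E.
    assert (Hw2 : (a1 - x) ^ 2 + (a2 - y) ^ 2 <> 0) by now apply Rgt_not_eq, sum_sqr_pos.
    assert (Hv2 : v1 ^ 2 + v2 ^ 2 <> 0) by now apply Rgt_not_eq, sum_sqr_pos.
    assert (Hr2 : r ^ 2 <> 0) by (apply pow_nonzero; lra).
    set (W := (a1 - x) ^ 2 + (a2 - y) ^ 2) in *. set (V := v1 ^ 2 + v2 ^ 2) in *.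
    apply (Rmult_eq_reg_r (r ^ 2 * W * V)); [lra |].
    apply Rmult_integral_contrapositive_currified; [| assumption].
    apply Rmult_integral_contrapositive_currified; assumption. }
  assert (Ray : forall m, m <> 0 -> sin ti = m * sin to ->
    refracted_ray (a1, a2) (circle (o1, o2) r) m (x, y) L).
  { intros m Hm Em. split; [assumption |].
    exists (line (x, y) (p1, p2)), ti, to.
    split; [assumption |]. split; [assumption |].
    split; [| split; [assumption |]; split; [assumption |]].
    - rewrite Em. replace (/ m * (m * sin to)) with (sin to) by (field; assumption).
      apply SIN_bound.
    - intro Z. apply sin_eq_0_angle; [assumption |].
      rewrite Z, sin_0 in Em. apply (Rmult_eq_reg_l m); [lra | assumption]. }
  assert (F : (sin ti - n * sin to) * (sin ti + n * sin to) = 0).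
  { transitivity (sin ti ^ 2 - n ^ 2 * sin to ^ 2); [ring | lra]. }
  apply Rmult_integral in F. destruct F as [F | F].
  - left. apply Ray; lra.
  - right. apply Ray; lra.
Qed.

(** * The circle and its inverse foci *)

Lemma sign_exists (z : R) : exists sigma, is_sign sigma /\ Rabs z = sigma * z.
Proof.
  destruct (Rle_dec 0 z).
  - exists 1. split; [now right |]. rewrite Rabs_pos_eq; lra.
  - exists (-1). split; [now left |]. rewrite Rabs_left; lra.
Qed.

Lemma Rabs_sqr (z : R) : Rabs z ^ 2 = z ^ 2.
Proof. rewrite RPow_abs. apply Rabs_pos_eq, pow2_ge_0. Qed.

Lemma dist2_refl (x y : R) : dist2 x y x y = 0.
Proof. apply dist2_eq; [lra | ring]. Qed.

Lemma cross_zero_trans (p1 p2 v1 v2 w1 w2 : R) : p1 <> 0 \/ p2 <> 0 ->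
  p1 * v2 - p2 * v1 = 0 -> p1 * w2 - p2 * w1 = 0 -> v1 * w2 = v2 * w1.
Proof.
  intros Hp H K.
  destruct Hp; [apply Rmult_eq_reg_l with p1 | apply Rmult_eq_reg_l with p2];
    try assumption; nsatz.
Qed.

(* [M = X + mu v] lies on the circle through [A = X + w] that is tangent at [X]
   to the normal [p] of the refracting circle. *)
Lemma chord_sqr (r p1 p2 v1 v2 w1 w2 mu : R) :
  p1 ^ 2 + p2 ^ 2 = r ^ 2 -> v1 ^ 2 + v2 ^ 2 = 1 ->
  mu * (p1 * w2 - p2 * w1) = (w1 ^ 2 + w2 ^ 2) * (p1 * v2 - p2 * v1) ->
  p1 * w2 - p2 * w1 <> 0 ->
  (w1 - mu * v1) ^ 2 + (w2 - mu * v2) ^ 2 =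
  (w1 ^ 2 + w2 ^ 2) * r ^ 2 * (w1 * v2 - w2 * v1) ^ 2 / (p1 * w2 - p2 * w1) ^ 2.
Proof.
  intros Hp Hv Hmu HW.
  assert (E : mu = (w1 ^ 2 + w2 ^ 2) * (p1 * v2 - p2 * v1) / (p1 * w2 - p2 * w1)).
  { rewrite <- Hmu. field. assumption. }
  transitivity (w1 ^ 2 + w2 ^ 2 - 2 * mu * (v1 * w1 + v2 * w2) + mu ^ 2 * (v1 ^ 2 + v2 ^ 2));
    [ring |].
  rewrite <- Hp, Hv, E.
  transitivity ((w1 ^ 2 + w2 ^ 2) / (p1 * w2 - p2 * w1) ^ 2 *
    ((p1 * w2 - p2 * w1) ^ 2 * 1
      - 2 * (p1 * v2 - p2 * v1) * (p1 * w2 - p2 * w1) * (v1 * w1 + v2 * w2)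
      + (p1 * v2 - p2 * v1) ^ 2 * (w1 ^ 2 + w2 ^ 2))).
  - field. assumption.
  - rewrite <- Hv. field. assumption.
Qed.

Lemma cross_parallel (p1 p2 v1 v2 w1 w2 : R) :
  v1 ^ 2 + v2 ^ 2 = 1 -> v1 * w2 = v2 * w1 ->
  (p1 * w2 - p2 * w1) ^ 2 = (p1 * v2 - p2 * v1) ^ 2 * (w1 ^ 2 + w2 ^ 2).
Proof.
  intros Hv H. set (l := v1 * w1 + v2 * w2).
  assert (E1 : w1 = l * v1).
  { transitivity (w1 * (v1 ^ 2 + v2 ^ 2) + v2 * (v1 * w2 - v2 * w1));
      [rewrite Hv, H; ring | unfold l; ring]. }
  assert (E2 : w2 = l * v2).
  { transitivity (w2 * (v1 ^ 2 + v2 ^ 2) - v1 * (v1 * w2 - v2 * w1));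
      [rewrite Hv, H; ring | unfold l; ring]. }
  rewrite E1, E2.
  transitivity (l ^ 2 * (p1 * v2 - p2 * v1) ^ 2 * 1); [ring | rewrite <- Hv; ring].
Qed.

Section Configuration.

Variables (o1 o2 r a1 a2 b1 b2 a n : R).
Hypotheses (hr : 0 < r) (ha : 0 < a) (har : a <> r) (hn : n <> 0).
Hypothesis (hq : (a1 - o1) ^ 2 + (a2 - o2) ^ 2 = a ^ 2).
Hypothesis (hb1 : b1 = o1 + r ^ 2 / a ^ 2 * (a1 - o1)).
Hypothesis (hb2 : b2 = o2 + r ^ 2 / a ^ 2 * (a2 - o2)).

Lemma focus_sqr : a ^ 2 <> r ^ 2.
Proof. intro E. apply har. nra. Qed.

Lemma foci_dist : dist2 a1 a2 b1 b2 = Rabs (a ^ 2 - r ^ 2) / a.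
Proof.
  apply dist2_eq.
  - apply Rmult_le_pos; [apply Rabs_pos | left; now apply Rinv_0_lt_compat].
  - unfold Rdiv. rewrite Rpow_mult_distr, Rabs_sqr, hb1, hb2.
    transitivity ((a ^ 2 - r ^ 2) ^ 2 / a ^ 4 * ((a1 - o1) ^ 2 + (a2 - o2) ^ 2));
      [rewrite hq |]; field; lra.
Qed.

Lemma foci_neq : (a1, a2) <> (b1, b2).
Proof.
  intro E. assert (H : dist2 a1 a2 b1 b2 = 0) by (injection E as <- <-; apply dist2_refl).
  rewrite foci_dist in H. apply focus_sqr.
  apply Rmult_integral in H. destruct H as [H | H].
  - destruct (Req_dec (a ^ 2 - r ^ 2) 0) as [|h]; [lra | now apply Rabs_no_R0 in h].
  - exfalso. revert H. apply Rinv_neq_0_compat. lra.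
Qed.

Lemma center_neq : a1 - o1 <> 0 \/ a2 - o2 <> 0.
Proof.
  destruct (Req_dec (a1 - o1) 0) as [e |]; [right | now left].
  intro e'. rewrite e, e' in hq. pose proof (pow_lt a 2 ha). lra.
Qed.

Lemma not_on_circle x y : circle (o1, o2) r (x, y) -> (x, y) <> (a1, a2).
Proof.
  intros HX E. apply circle_sqr in HX. injection E as -> ->. apply focus_sqr. lra.
Qed.

Lemma axis_same x y v1 v2 : v1 <> 0 \/ v2 <> 0 ->
  v1 * (a2 - y) = v2 * (a1 - x) -> v1 * (o2 - y) = v2 * (o1 - x) ->
  same (line (x, y) (v1, v2)) (line_through (a1, a2) (o1, o2)).
Proof.
  intros Hv HA HO. rewrite line_through_eq. apply line_same; try assumption; [| lra].
  destruct center_neq; [left | right]; lra.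
Qed.

(** With [p = X - O] and [w = A - X], the left side is [|XB|^2]: the circle is an Apollonius circle
    of its inverse points. *)
Lemma inverse_focus_sqr p1 p2 w1 w2 :
  p1 ^ 2 + p2 ^ 2 = r ^ 2 -> (w1 + p1) ^ 2 + (w2 + p2) ^ 2 = a ^ 2 ->
  (r ^ 2 / a ^ 2 * (w1 + p1) - p1) ^ 2 + (r ^ 2 / a ^ 2 * (w2 + p2) - p2) ^ 2 =
  r ^ 2 / a ^ 2 * (w1 ^ 2 + w2 ^ 2).
Proof.
  intros Hp Hq.
  transitivity ((r ^ 2 / a ^ 2) ^ 2 * ((w1 + p1) ^ 2 + (w2 + p2) ^ 2)
    - r ^ 2 / a ^ 2 * (2 * (p1 ^ 2 + p2 ^ 2) + 2 * (p1 * w1 + p2 * w2))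
    + (p1 ^ 2 + p2 ^ 2)); [field; lra |].
  transitivity (r ^ 2 / a ^ 2 * (((w1 + p1) ^ 2 + (w2 + p2) ^ 2)
    - 2 * (p1 * w1 + p2 * w2) - (p1 ^ 2 + p2 ^ 2)));
    [rewrite Hq, Hp; field; lra | ring].
Qed.

Lemma oval_of_refracted_ray (L : pset) :
  refracted_rays (a1, a2) (circle (o1, o2) r) n L ->
  ~ L (a1, a2) -> ~ L (b1, b2) ->
  exists sigma1 sigma2 x y, is_sign sigma1 /\ is_sign sigma2 /\
     (x, y) <> (a1, a2) /\ (x, y) <> (b1, b2) /\
     oval (a1, a2) (b1, b2) a r n sigma1 sigma2 (x, y) /\
     same L (line (x, y) (oval_grad_x a1 a2 b1 b2 (sigma1 * (a / r)) (x, y),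
                          oval_grad_y a1 a2 b1 b2 (sigma1 * (a / r)) (x, y))).
Proof.
  intros [[x y] HR] HLA HLB.
  assert (Hr0 : r <> 0) by lra. assert (Ha0 : a <> 0) by lra.
  assert (HS : circle (o1, o2) r (x, y) /\ exists v1 v2, v1 ^ 2 + v2 ^ 2 = 1 /\
    same L (line (x, y) (v1, v2)) /\
    ((x - o1) * (a2 - y) - (y - o2) * (a1 - x)) ^ 2 =
    n ^ 2 * ((x - o1) * v2 - (y - o2) * v1) ^ 2 * ((a1 - x) ^ 2 + (a2 - y) ^ 2)).
  { destruct HR as [HR | HR]; apply refracted_ray_snell in HR; try assumption.
    replace (n ^ 2) with ((- n) ^ 2) by ring. exact HR. }
  clear HR. destruct HS as (HX & v1 & v2 & Hv & HL & E).
  assert (Hv0 : v1 <> 0 \/ v2 <> 0).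
  { destruct (Req_dec v1 0) as [e |]; [right | now left].
    intro e'. rewrite e, e' in Hv. lra. }
  rewrite (HL (a1, a2)), line_iff in HLA by assumption.
  rewrite (HL (b1, b2)), line_iff in HLB by assumption.
  pose proof (pair_neq _ _ _ _ (not_on_circle x y HX)) as Hw0.
  pose proof (circle_sqr _ _ _ _ _ HX) as Hp.
  assert (Hb1 : b1 - x = r ^ 2 / a ^ 2 * ((a1 - x) + (x - o1)) - (x - o1))
    by (rewrite hb1; ring).
  assert (Hb2 : b2 - y = r ^ 2 / a ^ 2 * ((a2 - y) + (y - o2)) - (y - o2))
    by (rewrite hb2; ring).
  set (p1 := x - o1) in *. set (p2 := y - o2) in *.
  set (w1 := a1 - x) in *. set (w2 := a2 - y) in *.
  assert (Hq : (w1 + p1) ^ 2 + (w2 + p2) ^ 2 = a ^ 2)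
    by (rewrite <- hq; unfold p1, p2, w1, w2; ring).
  set (D := w1 ^ 2 + w2 ^ 2) in *.
  assert (HD : 0 < D) by now apply sum_sqr_pos.
  set (W := p1 * w2 - p2 * w1) in *. set (C := p1 * v2 - p2 * v1) in *.
  assert (Hp0 : p1 <> 0 \/ p2 <> 0).
  { destruct (Req_dec p1 0) as [e |]; [right | now left].
    intro e'. rewrite e, e' in Hp. pose proof (pow_lt r 2 hr). lra. }
  (* If the light ray were the normal at [X], Snell's law would make [L] the same line, and [L]
     would contain [A]. *)
  assert (HW : W <> 0).
  { intro W0. apply HLA. apply (cross_zero_trans p1 p2 v1 v2 w1 w2 Hp0); [| exact W0].
    fold C. rewrite W0 in E.
    assert (K : n ^ 2 * C ^ 2 * D = 0) by lra.
    apply Rmult_integral in K. destruct K as [K | K]; [| lra].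
    apply Rmult_integral in K. destruct K as [K | K]; [now apply pow_nonzero in K |].
    destruct (Req_dec C 0) as [|h]; [assumption | now apply (pow_nonzero C 2) in h]. }
  (* The circle through [A] tangent to [p] at [X] consists of the points [X + m] with
     [|m|^2 * W = D * (p x m)], where [x] is the cross product. Putting [m = mu * v] gives this
     value. *)
  set (mu := D * C / W).
  set (ca := w1 * v2 - w2 * v1).
  assert (Hca : ca <> 0) by (unfold ca; lra).
  set (z1 := b1 - x) in *. set (z2 := b2 - y) in *.
  set (cb := z1 * v2 - z2 * v1).
  assert (Hcb : cb <> 0) by (unfold cb; lra).
  (* Replacing [A] by [B] multiplies [D] and [W] by the same factor [r^2 / a^2], so [B] lies on the
     same circle and yields the same [mu]. *)
  assert (HDb : z1 ^ 2 + z2 ^ 2 = r ^ 2 / a ^ 2 * D)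
    by (rewrite Hb1, Hb2; now apply inverse_focus_sqr).
  assert (HWb : p1 * z2 - p2 * z1 = r ^ 2 / a ^ 2 * W)
    by (rewrite Hb1, Hb2; unfold W; ring).
  assert (Hlam : r ^ 2 / a ^ 2 <> 0).
  { apply Rmult_integral_contrapositive; split;
      [| apply Rinv_neq_0_compat]; apply pow_nonzero; assumption. }
  set (h := sqrt D).
  assert (Hh : 0 < h) by now apply sqrt_lt_R0.
  assert (Hh2 : h ^ 2 = D) by (apply pow2_sqrt; lra).
  assert (HWa : 0 < Rabs W) by now apply Rabs_pos_lt.
  assert (Hcaa : 0 < Rabs ca) by now apply Rabs_pos_lt.
  assert (Hcba : 0 < Rabs cb) by now apply Rabs_pos_lt.
  assert (Hna0 : Rabs n <> 0) by now apply Rabs_no_R0.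
  assert (HWa0 : Rabs W <> 0) by now apply Rabs_no_R0.
  assert (Hcaa0 : Rabs ca <> 0) by now apply Rabs_no_R0.
  assert (Hcba0 : Rabs cb <> 0) by now apply Rabs_no_R0.
  assert (Hh0 : h <> 0) by now apply Rgt_not_eq.
  assert (PA : 0 < h * r * Rabs ca / Rabs W).
  { apply Rdiv_lt_0_compat; [| assumption].
    apply Rmult_lt_0_compat; [apply Rmult_lt_0_compat |]; assumption. }
  assert (PB : 0 < a * h * Rabs cb / Rabs W).
  { apply Rdiv_lt_0_compat; [| assumption].
    apply Rmult_lt_0_compat; [apply Rmult_lt_0_compat |]; assumption. }
  assert (dA : dist2 a1 a2 (x + mu * v1) (y + mu * v2) = h * r * Rabs ca / Rabs W).
  { apply dist2_eq.
    - now left.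
    - transitivity (h ^ 2 * r ^ 2 * Rabs ca ^ 2 / Rabs W ^ 2); [field; repeat split; assumption |].
      rewrite !Rabs_sqr, Hh2.
      pose proof (chord_sqr r p1 p2 v1 v2 w1 w2 mu Hp Hv) as K.
      unfold ca, W, D. rewrite <- K.
      + unfold w1, w2. ring.
      + fold W. fold D. fold C. unfold mu. field. assumption.
      + exact HW. }
  assert (dB : dist2 b1 b2 (x + mu * v1) (y + mu * v2) = a * h * Rabs cb / Rabs W).
  { apply dist2_eq.
    - now left.
    - transitivity (a ^ 2 * h ^ 2 * Rabs cb ^ 2 / Rabs W ^ 2); [field; repeat split; assumption |].
      rewrite !Rabs_sqr, Hh2.
      pose proof (chord_sqr r p1 p2 v1 v2 z1 z2 mu Hp Hv) as K.
      rewrite HDb, HWb in K. fold cb C in K.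
      transitivity (r ^ 2 / a ^ 2 * D * r ^ 2 * cb ^ 2 / (r ^ 2 / a ^ 2 * W) ^ 2);
        [field; repeat split; assumption |].
      rewrite <- K.
      + unfold z1, z2. ring.
      + unfold mu. field. repeat split; assumption.
      + now apply Rmult_integral_contrapositive. }
  assert (EW : Rabs W = Rabs n * Rabs C * h).
  { rewrite <- Rabs_mult, <- (Rabs_pos_eq h), <- Rabs_mult by lra.
    apply Rsqr_eq_abs_0. unfold Rsqr.
    transitivity (W ^ 2); [ring |]. rewrite E, <- Hh2. ring. }
  (* [sa] and [sb] record the sides of the ray on which [A] and [B] lie; they fix [sigma1], while
     [sc] is needed for the sign of the right-hand side. *)
  destruct (sign_exists ca) as (sa & Sa & Ea).
  destruct (sign_exists cb) as (sb & Sb & Eb).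
  destruct (sign_exists ((a ^ 2 - r ^ 2) * C)) as (sc & Sc & Ec).
  pose proof (sign_sqr _ Sa) as Sa2. pose proof (sign_sqr _ Sb) as Sb2.
  pose proof (sign_sqr _ Sc) as Sc2.
  assert (S1 : is_sign (- (sa * sb)))
    by (destruct Sa as [-> | ->], Sb as [-> | ->]; [left | right | right | left]; ring).
  assert (S2 : is_sign (sa * sc))
    by (destruct Sa as [-> | ->], Sc as [-> | ->]; [right | left | left | right]; ring).
  exists (- (sa * sb)), (sa * sc), (x + mu * v1), (y + mu * v2).
  assert (HMA : (x + mu * v1, y + mu * v2) <> (a1, a2)).
  { intro K. injection K as K1 K2. rewrite K1, K2, dist2_refl in dA.
    rewrite <- dA in PA. exact (Rlt_irrefl 0 PA). }
  assert (HMB : (x + mu * v1, y + mu * v2) <> (b1, b2)).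
  { intro K. injection K as K1 K2. rewrite K1, K2, dist2_refl in dB.
    rewrite <- dB in PB. exact (Rlt_irrefl 0 PB). }
  split; [assumption |]. split; [assumption |].
  split; [assumption |]. split; [assumption |]. split.
  - unfold oval, cartesian_oval. rewrite !norm_minus, dA, dB, foci_dist.
    assert (HC0 : Rabs C <> 0).
    { intro K. rewrite K, Rmult_0_r, Rmult_0_l in EW. contradiction. }
    (* Ptolemy's theorem with signed lengths: up to common factors the three terms are the products
       of opposite sides and of diagonals. *)
    assert (Id : r ^ 2 * ca - a ^ 2 * cb = (a ^ 2 - r ^ 2) * C).
    { unfold cb. rewrite Hb1, Hb2. unfold ca, C. field. repeat split; assumption. }
    assert (Id2 : r ^ 2 * Rabs ca - sa * sb * (a ^ 2 * Rabs cb) =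
                  sa * sc * (Rabs (a ^ 2 - r ^ 2) * Rabs C)).
    { rewrite <- Rabs_mult, Ea, Eb, Ec.
      transitivity (sa * (r ^ 2 * ca) - sa * sb ^ 2 * (a ^ 2 * cb)); [ring |].
      transitivity (sa * sc ^ 2 * ((a ^ 2 - r ^ 2) * C)); [| ring].
      rewrite Sb2, Sc2, <- Id. ring. }
    transitivity (h / (r * Rabs W) * (r ^ 2 * Rabs ca - sa * sb * (a ^ 2 * Rabs cb)));
      [field; repeat split; assumption |].
    rewrite Id2, EW. field. repeat split; assumption.
  - apply same_trans with (1 := HL).
    destruct (oval_slope a r _ ha hr har S1) as [_ Hs1].
    apply line_same; [assumption | now apply oval_grad_neq0 | | ring].
    unfold oval_grad_x, oval_grad_y. cbn [fst snd]. rewrite dA, dB.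
    replace (x + mu * v1 - a1) with (mu * v1 - w1) by (unfold w1; ring).
    replace (y + mu * v2 - a2) with (mu * v2 - w2) by (unfold w2; ring).
    replace (x + mu * v1 - b1) with (mu * v1 - z1) by (unfold z1; ring).
    replace (y + mu * v2 - b2) with (mu * v2 - z2) by (unfold z2; ring).
    assert (Na : ca / Rabs ca = sa).
    { apply (Rmult_eq_reg_r (Rabs ca)); [| assumption].
      transitivity (sa ^ 2 * ca); [rewrite Sa2; field; assumption | rewrite Ea; ring]. }
    assert (Nb : cb / Rabs cb = sb).
    { apply (Rmult_eq_reg_r (Rabs cb)); [| assumption].
      transitivity (sb ^ 2 * cb); [rewrite Sb2; field; assumption | rewrite Eb; ring]. }
    apply Rminus_diag_uniq.
    (* The components of the two gradient terms orthogonal to [v] have the same modulus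
       [Rabs W / (h * r)]; the choice of [sigma1] makes them cancel. *)
    transitivity (Rabs W / (h * r) * (ca / Rabs ca - sa * sb * (cb / Rabs cb)));
      [unfold ca, cb; field; repeat split; assumption |].
    rewrite Na, Nb.
    transitivity (Rabs W / (h * r) * (sa - sa * sb ^ 2)); [ring |]. rewrite Sb2. ring.
Qed.

(** * From a normal of an oval back to its refracted ray *)

Lemma radii_neq0 : r <> 0 /\ a <> 0.
Proof. lra. Qed.

(* [X] is the second intersection of the normal at [M] with the circle through
   [A], [B] and [M]. *)
Lemma second_intersection (S T u v c1 c2 e1 e2 k x y : R) :
  c1 ^ 2 + c2 ^ 2 = 1 -> e1 ^ 2 + e2 ^ 2 = 1 -> S ^ 2 * r ^ 2 = a ^ 2 ->
  a1 = x - u * c1 -> a2 = y - u * c2 -> b1 = x - v * e1 -> b2 = y - v * e2 ->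
  u + S * v = T ->
  (c1 + S * e1) ^ 2 + (c2 + S * e2) ^ 2 <> 0 ->
  k * ((c1 + S * e1) ^ 2 + (c2 + S * e2) ^ 2) = T ->
  T ^ 2 * n ^ 2 * r ^ 2 = a ^ 2 * ((a1 - b1) ^ 2 + (a2 - b2) ^ 2) ->
  let X1 := x - k * (c1 + S * e1) in let X2 := y - k * (c2 + S * e2) in
  (X1 - o1) ^ 2 + (X2 - o2) ^ 2 = r ^ 2 /\
  ((X1 - o1) * (a2 - X2) - (X2 - o2) * (a1 - X1)) ^ 2 *
    ((c1 + S * e1) ^ 2 + (c2 + S * e2) ^ 2) =
  n ^ 2 * ((X1 - o1) * (c2 + S * e2) - (X2 - o2) * (c1 + S * e1)) ^ 2 *
    ((a1 - X1) ^ 2 + (a2 - X2) ^ 2).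
Proof.
  intros Hc He HS A1 A2 B1 B2 HT HG Hk Hn X1 X2.
  destruct radii_neq0 as [Hr0 Ha0].
  (* Cosine and sine of the angle [AMB]; [d2] is then [|AB|^2] by the law of cosines. *)
  set (gm := c1 * e1 + c2 * e2).
  set (kp := c1 * e2 - c2 * e1).
  set (d2 := u ^ 2 + v ^ 2 - 2 * u * v * gm).
  set (g1 := c1 + S * e1) in *. set (g2 := c2 + S * e2) in *.
  set (G := g1 ^ 2 + g2 ^ 2) in *.
  assert (EG : G = 1 + S ^ 2 + 2 * S * gm).
  { rewrite <- Hc at 1. rewrite <- (Rmult_1_r (S ^ 2)), <- He. unfold G, g1, g2, gm. ring. }
  assert (Hd : (a1 - b1) ^ 2 + (a2 - b2) ^ 2 = d2).
  { rewrite A1, A2, B1, B2.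
    transitivity (u ^ 2 * (c1 ^ 2 + c2 ^ 2) + v ^ 2 * (e1 ^ 2 + e2 ^ 2) - 2 * u * v * gm);
      [unfold gm; ring | rewrite Hc, He; unfold d2; ring]. }
  assert (EA : G * ((X1 - a1) ^ 2 + (X2 - a2) ^ 2) = S ^ 2 * d2).
  { transitivity (u ^ 2 * (c1 ^ 2 + c2 ^ 2) * G
      - 2 * u * (k * G) * ((c1 ^ 2 + c2 ^ 2) + S * gm) + (k * G) ^ 2).
    - unfold X1, X2. rewrite A1, A2. unfold G, g1, g2, gm. ring.
    - rewrite Hc, Hk, EG, <- HT. unfold d2. ring. }
  assert (EB : G * ((X1 - b1) ^ 2 + (X2 - b2) ^ 2) = d2).
  { transitivity (v ^ 2 * (e1 ^ 2 + e2 ^ 2) * G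
      - 2 * v * (k * G) * (gm + S * (e1 ^ 2 + e2 ^ 2)) + (k * G) ^ 2).
    - unfold X1, X2. rewrite B1, B2. unfold G, g1, g2, gm. ring.
    - rewrite He, Hk, EG, <- HT. unfold d2. ring. }
  (* [|XA| = |S| |XB|] with [|S| = a / r] is the Apollonius description of the refracting circle, so
     [X] lies on it. The centre obeys [(S^2 - 1) O = S^2 B - A], hence the factor [S^2 - 1]
     below. *)
  assert (EAB : (X1 - a1) ^ 2 + (X2 - a2) ^ 2 = S ^ 2 * ((X1 - b1) ^ 2 + (X2 - b2) ^ 2)).
  { apply (Rmult_eq_reg_l G); [| assumption]. rewrite EA, <- EB. ring. }
  assert (HS2 : S ^ 2 = a ^ 2 / r ^ 2) by (rewrite <- HS; field; assumption).
  assert (HS1 : S ^ 2 - 1 <> 0).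
  { intro E. apply focus_sqr. rewrite <- HS. replace (S ^ 2) with 1 by lra. ring. }
  split.
  - apply (Rmult_eq_reg_l (S ^ 2 - 1)); [| assumption].
    transitivity ((S ^ 2 * ((X1 - b1) ^ 2 + (X2 - b2) ^ 2)
      - S ^ 2 * (r ^ 2 / a ^ 2) ^ 2 * ((a1 - o1) ^ 2 + (a2 - o2) ^ 2))
      - (((X1 - a1) ^ 2 + (X2 - a2) ^ 2) - ((a1 - o1) ^ 2 + (a2 - o2) ^ 2))).
    + rewrite hb1, hb2, HS2. field. split; assumption.
    + rewrite EAB, hq, HS2. field. split; assumption.
  - assert (O1 : (S ^ 2 - 1) * o1 = S ^ 2 * b1 - a1)
      by (rewrite hb1, HS2; field; split; assumption).
    assert (O2 : (S ^ 2 - 1) * o2 = S ^ 2 * b2 - a2)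
      by (rewrite hb2, HS2; field; split; assumption).
    set (cA := (X1 - o1) * (a2 - X2) - (X2 - o2) * (a1 - X1)).
    set (cg := (X1 - o1) * g2 - (X2 - o2) * g1).
    (* Both cross products in Snell's law are multiples of [kp]; what remains after cancelling is
       [n^2 T^2 = S^2 |AB|^2], the value prescribed for the oval. *)
    assert (F1 : (S ^ 2 - 1) * G * cA = - (S ^ 3 * kp * d2)).
    { transitivity (((S ^ 2 - 1) * a1 - (S ^ 2 - 1) * o1) * (G * (a2 - y) + (k * G) * g2)
        - ((S ^ 2 - 1) * a2 - (S ^ 2 - 1) * o2) * (G * (a1 - x) + (k * G) * g1)).
      - unfold cA, X1, X2. ring.
      - rewrite O1, O2, Hk, EG, <- HT, A1, A2, B1, B2.
        unfold d2, kp, gm, g1, g2. ring. }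
    assert (F2 : (S ^ 2 - 1) * cg = - (S * T * kp)).
    { transitivity (((S ^ 2 - 1) * x - (S ^ 2 - 1) * o1) * g2
        - ((S ^ 2 - 1) * y - (S ^ 2 - 1) * o2) * g1).
      - unfold cg, X1, X2. ring.
      - rewrite O1, O2, <- HT, A1, A2, B1, B2. unfold kp, g1, g2. ring. }
    assert (Hn2 : n ^ 2 * T ^ 2 = S ^ 2 * d2).
    { rewrite HS2, <- Hd. apply (Rmult_eq_reg_r (r ^ 2)); [| now apply pow_nonzero].
      transitivity (T ^ 2 * n ^ 2 * r ^ 2); [ring |]. rewrite Hn. field. assumption. }
    apply (Rmult_eq_reg_r ((S ^ 2 - 1) ^ 2 * G));
      [| apply Rmult_integral_contrapositive_currified;
         [now apply pow_nonzero | assumption]].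
    transitivity (((S ^ 2 - 1) * G * cA) ^ 2); [ring |].
    transitivity (n ^ 2 * ((S ^ 2 - 1) * cg) ^ 2 * (G * ((X1 - a1) ^ 2 + (X2 - a2) ^ 2)));
      [| ring].
    rewrite F1, F2, EA.
    transitivity ((n ^ 2 * T ^ 2) * S ^ 4 * kp ^ 2 * d2); [| ring].
    rewrite Hn2. ring.
Qed.

(** If the normal at [M] contains one focus, then the gradient is parallel to one of its two unit
    vectors, hence to both, and [M], [A], [B] are aligned. *)
Lemma refracted_ray_of_oval (L : pset) (sigma1 sigma2 x y : R) :
  is_sign sigma1 -> is_sign sigma2 -> (x, y) <> (a1, a2) -> (x, y) <> (b1, b2) ->
  oval (a1, a2) (b1, b2) a r n sigma1 sigma2 (x, y) ->
  same L (line (x, y) (oval_grad_x a1 a2 b1 b2 (sigma1 * (a / r)) (x, y),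
                       oval_grad_y a1 a2 b1 b2 (sigma1 * (a / r)) (x, y))) ->
  refracted_rays (a1, a2) (circle (o1, o2) r) n L /\
  (L (a1, a2) \/ L (b1, b2) -> same L (line_through (a1, a2) (o1, o2))).
Proof.
  intros S1 S2 HMA HMB HO HL.
  destruct radii_neq0 as [Hr0 Ha0].
  destruct (oval_slope a r _ ha hr har S1) as [Hs0 Hs1].
  pose proof (oval_grad_neq0 a1 a2 b1 b2 _ x y Hs1 HMA HMB) as Hg.
  assert (Hu := dist2_pos a1 a2 x y ltac:(congruence)).
  assert (Hv := dist2_pos b1 b2 x y ltac:(congruence)).
  pose proof (dist2_sqr a1 a2 x y) as Eu. pose proof (dist2_sqr b1 b2 x y) as Ev.
  pose proof (dist2_sqr a1 a2 b1 b2) as Ed.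
  unfold oval, cartesian_oval in HO. rewrite !norm_minus in HO.
  unfold oval_grad_x, oval_grad_y in HL, Hg. cbn [fst snd] in HL, Hg.
  set (u := dist2 a1 a2 x y) in *. set (v := dist2 b1 b2 x y) in *.
  set (d := dist2 a1 a2 b1 b2) in *.
  assert (Hu0 : u <> 0) by lra. assert (Hv0 : v <> 0) by lra.
  set (S := sigma1 * (a / r)) in *.
  set (T := sigma2 * (a * d / (r * Rabs n))) in *.
  assert (Hn0 : Rabs n <> 0) by now apply Rabs_no_R0.
  assert (HS : S ^ 2 * r ^ 2 = a ^ 2).
  { unfold S. transitivity (sigma1 ^ 2 * a ^ 2); [field; assumption |].
    rewrite (sign_sqr _ S1). ring. }
  assert (HT : T ^ 2 * n ^ 2 * r ^ 2 = a ^ 2 * ((a1 - b1) ^ 2 + (a2 - b2) ^ 2)).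
  { rewrite <- Ed, <- (Rabs_sqr n). unfold T.
    transitivity (sigma2 ^ 2 * (a ^ 2 * d ^ 2)); [field; split; assumption |].
    rewrite (sign_sqr _ S2). ring. }
  set (c1 := (x - a1) / u) in *. set (c2 := (y - a2) / u) in *.
  set (e1 := (x - b1) / v) in *. set (e2 := (y - b2) / v) in *.
  assert (Hc : c1 ^ 2 + c2 ^ 2 = 1).
  { unfold c1, c2. transitivity (((a1 - x) ^ 2 + (a2 - y) ^ 2) / u ^ 2);
      [field; assumption | rewrite <- Eu; field; assumption]. }
  assert (He : e1 ^ 2 + e2 ^ 2 = 1).
  { unfold e1, e2. transitivity (((b1 - x) ^ 2 + (b2 - y) ^ 2) / v ^ 2);
      [field; assumption | rewrite <- Ev; field; assumption]. }
  assert (A1 : a1 = x - u * c1) by (unfold c1; field; assumption).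
  assert (A2 : a2 = y - u * c2) by (unfold c2; field; assumption).
  assert (B1 : b1 = x - v * e1) by (unfold e1; field; assumption).
  assert (B2 : b2 = y - v * e2) by (unfold e2; field; assumption).
  pose proof (sum_sqr_pos _ _ Hg) as HG. apply Rgt_not_eq in HG.
  (* A circle through [M] is [|m|^2 = m . q] with [m] measured from [M]. Passing through [A] and [B]
     means [c . q = - u] and [e . q = - v], so the point [- k * g] with [g = c + S * e] requires
     [k * |g|^2 = u + S * v = T]. The formula still makes sense when [A], [B], [M] are aligned. *)
  set (k := T / ((c1 + S * e1) ^ 2 + (c2 + S * e2) ^ 2)).
  assert (Hk : k * ((c1 + S * e1) ^ 2 + (c2 + S * e2) ^ 2) = T)
    by (unfold k; field; assumption).
  destruct (second_intersection S T u v c1 c2 e1 e2 k x y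
    Hc He HS A1 A2 B1 B2 HO HG Hk HT) as [HX HR].
  set (g1 := c1 + S * e1) in *. set (g2 := c2 + S * e2) in *.
  split.
  - assert (HX' := circle_intro o1 o2 r _ _ hr HX).
    apply (snell_refracted o1 o2 r a1 a2 n _ _ g1 g2 L hr hn) in HX'; try assumption.
    + now apply not_on_circle.
    + apply same_trans with (1 := HL). apply line_same; try assumption; ring.
  - intros HAB.
    assert (K : c1 * e2 = c2 * e1).
    { destruct HAB as [HA | HB].
      - apply HL in HA. rewrite line_iff in HA by assumption.
        apply (Rmult_eq_reg_l (S * u)); [| now apply Rmult_integral_contrapositive].
        rewrite A1, A2 in HA. unfold g1, g2 in HA. lra.
      - apply HL in HB. rewrite line_iff in HB by assumption.
        apply (Rmult_eq_reg_l v); [| assumption].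
        rewrite B1, B2 in HB. unfold g1, g2 in HB. lra. }
    apply same_trans with (1 := HL).
    assert (KA : g1 * (a2 - y) = g2 * (a1 - x)).
    { replace (a2 - y) with (- u * c2) by (rewrite A2; ring).
      replace (a1 - x) with (- u * c1) by (rewrite A1; ring).
      apply Rminus_diag_uniq.
      transitivity (S * u * (c1 * e2 - c2 * e1)); [unfold g1, g2; ring | rewrite K; ring]. }
    apply axis_same; [assumption | assumption |].
    assert (KB : g1 * (b2 - y) = g2 * (b1 - x)).
    { replace (b2 - y) with (- v * e2) by (rewrite B2; ring).
      replace (b1 - x) with (- v * e1) by (rewrite B1; ring).
      apply Rminus_diag_uniq.
      transitivity (v * (c2 * e1 - c1 * e2)); [unfold g1, g2; ring | rewrite K; ring]. }
    (* [O] is on the line as well, because [(a^2 - r^2) O = a^2 B - r^2 A]. *)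
    apply (Rmult_eq_reg_l (a ^ 2 - r ^ 2)); [| pose proof focus_sqr; lra].
    transitivity (a ^ 2 * (g1 * (b2 - y)) - r ^ 2 * (g1 * (a2 - y)));
      [rewrite hb2; field; assumption |].
    rewrite KA, KB. rewrite hb1. field. assumption.
Qed.

(** * The axis and the rays through a focus *)

Lemma axis_refracted (L : pset) : same L (line_through (a1, a2) (o1, o2)) ->
  refracted_rays (a1, a2) (circle (o1, o2) r) n L.
Proof.
  intros HL. destruct radii_neq0 as [Hr0 Ha0].
  (* At this point the axis is the normal of the circle: both sides of the squared Snell law vanish,
     whatever [n] is. *)
  assert (HX : circle (o1, o2) r (o1 + r / a * (a1 - o1), o2 + r / a * (a2 - o2))).
  { apply circle_intro; [assumption |].
    transitivity (r ^ 2 / a ^ 2 * ((a1 - o1) ^ 2 + (a2 - o2) ^ 2));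
      [| rewrite hq]; field; assumption. }
  apply (snell_refracted o1 o2 r a1 a2 n _ _ (a1 - o1) (a2 - o2) L hr hn
           (not_on_circle _ _ HX) center_neq HX).
  - apply same_trans with (1 := HL). apply same_sym.
    apply axis_same; [apply center_neq | ring | ring].
  - ring.
Qed.

(** For every [n] some oval with [sigma1 = -1] crosses the axis outside the segment [AB]; there both
    unit vectors of the gradient lie along the axis. *)
Lemma axis_normal (L : pset) : same L (line_through (a1, a2) (o1, o2)) ->
  exists sigma1 sigma2 x y, is_sign sigma1 /\ is_sign sigma2 /\
     (x, y) <> (a1, a2) /\ (x, y) <> (b1, b2) /\
     oval (a1, a2) (b1, b2) a r n sigma1 sigma2 (x, y) /\
     same L (line (x, y) (oval_grad_x a1 a2 b1 b2 (sigma1 * (a / r)) (x, y),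
                          oval_grad_y a1 a2 b1 b2 (sigma1 * (a / r)) (x, y))).
Proof.
  intros HL. destruct radii_neq0 as [Hr0 Ha0].
  pose proof foci_neq as Hab. pose proof (dist2_pos _ _ _ _ Hab) as Hd.
  pose proof (dist2_sqr a1 a2 b1 b2) as Ed.
  set (d := dist2 a1 a2 b1 b2) in *. assert (Hd0 : d <> 0) by lra.
  assert (Hs : 0 < a / r) by now apply Rdiv_lt_0_compat.
  assert (Hs1 : a / r <> 1).
  { intro E. apply har. replace a with (a / r * r) by (field; assumption).
    rewrite E. ring. }
  assert (Ht : 0 < a * d / (r * Rabs n)).
  { apply Rdiv_lt_0_compat; apply Rmult_lt_0_compat; try assumption.
    now apply Rabs_pos_lt. }
  set (s := a / r) in *. set (t := a * d / (r * Rabs n)) in *.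
  (* Abscissa of that crossing, measured from [A] towards [B]. It lies beyond [A] if [s < 1] and
     beyond [B] if [s > 1]; [tau] is the common sign of [z] and [z - d]. *)
  set (z := (t + s * d) / (s - 1)).
  assert (Hz : z * (s - 1) = t + s * d) by (unfold z; field; lra).
  assert (Hsd : 0 < s * d) by now apply Rmult_lt_0_compat.
  set (f1 := (b1 - a1) / d). set (f2 := (b2 - a2) / d).
  assert (Hf : f1 ^ 2 + f2 ^ 2 = 1).
  { unfold f1, f2. transitivity (((a1 - b1) ^ 2 + (a2 - b2) ^ 2) / d ^ 2);
      [field; assumption | rewrite <- Ed; field; assumption]. }
  assert (B1 : b1 = a1 + d * f1) by (unfold f1; field; assumption).
  assert (B2 : b2 = a2 + d * f2) by (unfold f2; field; assumption).
  assert (Main : exists sigma2 tau, is_sign sigma2 /\ is_sign tau /\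
    0 < tau * z /\ 0 < tau * (z - d) /\ tau * z - s * (tau * (z - d)) = sigma2 * t).
  { destruct (Rlt_dec s 1) as [h | h].
    - assert (z < 0) by nra.
      exists 1, (-1). repeat split; try (now right); try (now left); lra.
    - assert (d < z) by nra.
      exists (-1), 1. repeat split; try (now right); try (now left); lra. }
  destruct Main as (sigma2 & tau & S2 & St & Z1 & Z2 & E).
  pose proof (sign_sqr _ St) as St2.
  assert (dA : dist2 a1 a2 (a1 + z * f1) (a2 + z * f2) = tau * z).
  { apply dist2_eq; [lra |].
    transitivity (z ^ 2 * (f1 ^ 2 + f2 ^ 2)); [| ring].
    rewrite Rpow_mult_distr, St2, Hf. ring. }
  assert (dB : dist2 b1 b2 (a1 + z * f1) (a2 + z * f2) = tau * (z - d)).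
  { apply dist2_eq; [lra |]. rewrite B1, B2.
    transitivity ((z - d) ^ 2 * (f1 ^ 2 + f2 ^ 2)); [| ring].
    rewrite Rpow_mult_distr, St2, Hf. ring. }
  assert (S1 : is_sign (-1)) by now left.
  assert (HMA : (a1 + z * f1, a2 + z * f2) <> (a1, a2)).
  { intro K. injection K as K1 K2. rewrite K1, K2, dist2_refl in dA. lra. }
  assert (HMB : (a1 + z * f1, a2 + z * f2) <> (b1, b2)).
  { intro K. injection K as K1 K2. rewrite K1, K2, dist2_refl in dB. lra. }
  exists (-1), sigma2, (a1 + z * f1), (a2 + z * f2).
  split; [assumption |]. split; [assumption |].
  split; [assumption |]. split; [assumption |]. split.
  - unfold oval, cartesian_oval. rewrite !norm_minus, dA, dB. fold d s t. lra.
  - destruct (oval_slope a r _ ha hr har S1) as [_ Hsl].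
    pose proof (oval_grad_neq0 a1 a2 b1 b2 _ _ _ Hsl HMA HMB) as Hg.
    assert (Hf1 : exists m, f1 = m * (a1 - o1) /\ f2 = m * (a2 - o2)).
    { exists ((r ^ 2 / a ^ 2 - 1) / d).
      unfold f1, f2. rewrite hb1, hb2. split; field; split; assumption. }
    destruct Hf1 as (m & M1 & M2).
    apply same_trans with (1 := HL). apply same_sym.
    assert (Hgf : exists l, oval_grad_x a1 a2 b1 b2 (-1 * s)
        (a1 + z * f1, a2 + z * f2) = l * (a1 - o1) /\
      oval_grad_y a1 a2 b1 b2 (-1 * s) (a1 + z * f1, a2 + z * f2) = l * (a2 - o2)).
    { exists ((z / (tau * z) + -1 * s * ((z - d) / (tau * (z - d)))) * m).
      unfold oval_grad_x, oval_grad_y. cbn [fst snd]. rewrite dA, dB.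
      rewrite !Rmult_assoc, <- M1, <- M2. rewrite B1, B2.
      split; unfold Rdiv; ring. }
    destruct Hgf as (l & G1 & G2).
    apply axis_same; [exact Hg | |]; rewrite G1, G2, M1, M2; ring.
Qed.

(** A line through [X] and [A] satisfies the squared Snell law with [n^2] replaced by 1, and one
    through [X] and [B] with [(a / r)^2]. If [n^2] is neither, both cross products vanish, and the
    ray is the normal at a point of the axis. *)
Lemma ray_through_focus (L : pset) : Rabs n <> 1 -> Rabs n <> a / r ->
  refracted_rays (a1, a2) (circle (o1, o2) r) n L -> L (a1, a2) \/ L (b1, b2) ->
  same L (line_through (a1, a2) (o1, o2)).
Proof.
  intros Hn1 Hnar [[x y] HR] HAB.
  destruct radii_neq0 as [Hr0 Ha0].
  assert (HS : circle (o1, o2) r (x, y) /\ exists v1 v2, v1 ^ 2 + v2 ^ 2 = 1 /\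
    same L (line (x, y) (v1, v2)) /\
    ((x - o1) * (a2 - y) - (y - o2) * (a1 - x)) ^ 2 =
    n ^ 2 * ((x - o1) * v2 - (y - o2) * v1) ^ 2 * ((a1 - x) ^ 2 + (a2 - y) ^ 2)).
  { destruct HR as [HR | HR]; apply refracted_ray_snell in HR; try assumption.
    replace (n ^ 2) with ((- n) ^ 2) by ring. exact HR. }
  clear HR. destruct HS as (HX & v1 & v2 & Hv & HL & E).
  assert (Hv0 : v1 <> 0 \/ v2 <> 0).
  { destruct (Req_dec v1 0) as [e |]; [right | now left].
    intro e'. rewrite e, e' in Hv. lra. }
  rewrite (HL (a1, a2)), (HL (b1, b2)), !line_iff in HAB by assumption.
  pose proof (pair_neq _ _ _ _ (not_on_circle x y HX)) as Hw0.
  pose proof (circle_sqr _ _ _ _ _ HX) as Hp.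
  assert (Hb1 : b1 - x = r ^ 2 / a ^ 2 * ((a1 - x) + (x - o1)) - (x - o1))
    by (rewrite hb1; ring).
  assert (Hb2 : b2 - y = r ^ 2 / a ^ 2 * ((a2 - y) + (y - o2)) - (y - o2))
    by (rewrite hb2; ring).
  apply same_trans with (1 := HL).
  assert (Ho1 : o1 - x = - (x - o1)) by ring. assert (Ho2 : o2 - y = - (y - o2)) by ring.
  assert (Hq : ((a1 - x) + (x - o1)) ^ 2 + ((a2 - y) + (y - o2)) ^ 2 = a ^ 2)
    by (rewrite <- hq; ring).
  assert (Ax : (x - o1) * v2 - (y - o2) * v1 = 0 ->
    (x - o1) * (a2 - y) - (y - o2) * (a1 - x) = 0 ->
    same (line (x, y) (v1, v2)) (line_through (a1, a2) (o1, o2))).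
  { intros K1 K2. apply axis_same; [assumption | | rewrite Ho1, Ho2; lra].
    apply (cross_zero_trans (x - o1) (y - o2)); try assumption.
    destruct (Req_dec (x - o1) 0) as [e |]; [right | now left].
    intro e'. rewrite e, e' in Hp. pose proof (pow_lt r 2 hr). lra. }
  set (p1 := x - o1) in *. set (p2 := y - o2) in *.
  set (w1 := a1 - x) in *. set (w2 := a2 - y) in *.
  set (W := p1 * w2 - p2 * w1) in *. set (C := p1 * v2 - p2 * v1) in *.
  pose proof (sum_sqr_pos _ _ Hw0) as HD. set (D := w1 ^ 2 + w2 ^ 2) in *.
  assert (Hn2 : forall c, 0 < c -> Rabs n <> c -> n ^ 2 <> c ^ 2).
  { intros c Hc Hnc E2. apply Hnc. rewrite <- Rabs_sqr in E2.
    apply Rsqr_inj; [apply Rabs_pos | lra | unfold Rsqr; lra]. }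
  assert (Fin : forall c, n ^ 2 <> c -> W ^ 2 = c * C ^ 2 * D ->
    W ^ 2 = 0 /\ C ^ 2 = 0).
  { intros c Hc K.
    assert (Z : (n ^ 2 - c) * D * C ^ 2 = 0) by lra.
    apply Rmult_integral in Z. destruct Z as [Z | Z].
    - exfalso. apply Rmult_integral in Z. destruct Z; lra.
    - split; [rewrite K, Z; ring | assumption]. }
  assert (Z : W ^ 2 = 0 /\ C ^ 2 = 0).
  { destruct HAB as [HA | HB].
    - apply (Fin 1); [rewrite <- (pow1 2); apply Hn2; lra |].
      rewrite Rmult_1_l. now apply cross_parallel.
    - apply (Fin ((a / r) ^ 2));
        [apply Hn2; [now apply Rdiv_lt_0_compat | assumption] |].
      rewrite Hb1, Hb2 in HB. apply (cross_parallel p1 p2) in HB; [| assumption].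
      rewrite inverse_focus_sqr in HB by assumption. fold C D in HB.
      apply (Rmult_eq_reg_l ((r ^ 2 / a ^ 2) ^ 2)).
      + transitivity (C ^ 2 * (r ^ 2 / a ^ 2 * D)); [| field; split; assumption].
        rewrite <- HB. unfold W. ring.
      + apply pow_nonzero, Rmult_integral_contrapositive; split;
          [| apply Rinv_neq_0_compat]; apply pow_nonzero; assumption. }
  destruct Z as [Z1 Z2].
  apply Ax.
  - destruct (Req_dec C 0) as [|h]; [assumption | now apply (pow_nonzero C 2) in h].
  - destruct (Req_dec W 0) as [|h]; [assumption | now apply (pow_nonzero W 2) in h].
Qed.

End Configuration.

(* The second clause restates the first for envelopes.  For [Rabs n] equal to 1
   or to [|A - O| / r], one of the families [R_n], [R_{-n}] consists of lines
   through [A], respectively [B], which (apart from [L_AO]) are not normals to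
   the ovals; hence the third clause, on all refracted rays, leaves out these
   two values. *)
Theorem theorem2p2 (O : plane) (r : R) (A B : plane) (n : R)
  (hr : 0 < r) (hAC : ~ circle O r A) (hAO : A <> O)
  (hB : B = plus O (scal (r ^ 2 / norm (minus A O) ^ 2) (minus A O)))
  (hn : n <> 0) :
  (forall L : pset,
    (refracted_rays A (circle O r) n L /\ ~ L A /\ ~ L B) <->
    ((exists C, real_oval A B (norm (minus A O)) r n C /\ normals C L) /\
     ~ same L (line_through A O))) /\
  (forall E : pset,
    is_envelope (fun L => refracted_rays A (circle O r) n L /\
                   (~ L A /\ ~ L B \/ same L (line_through A O))) E <->
    is_evolute (real_ovals_union A B (norm (minus A O)) r n) E) /\
  (Rabs n <> 1 -> Rabs n <> norm (minus A O) / r ->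
   forall E : pset,
    is_complete_caustic A (circle O r) n E <->
    is_evolute (real_ovals_union A B (norm (minus A O)) r n) E).
Proof.
  destruct O as [o1 o2], A as [a1 a2], B as [b1 b2].
  unfold circle in hAC. revert hAC hB. rewrite !norm_minus. intros har hB.
  assert (ha := dist2_pos a1 a2 o1 o2 hAO).
  assert (hq := dist2_sqr a1 a2 o1 o2). symmetry in hq.
  set (a := dist2 a1 a2 o1 o2) in *.
  assert (hb1 : b1 = o1 + r ^ 2 / a ^ 2 * (a1 - o1)) by exact (f_equal fst hB).
  assert (hb2 : b2 = o2 + r ^ 2 / a ^ 2 * (a2 - o2)) by exact (f_equal snd hB).
  assert (hab := foci_neq o1 o2 r a1 a2 b1 b2 a hr ha har hq hb1 hb2).
  assert (Eq : forall L : pset,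
    (refracted_rays (a1, a2) (circle (o1, o2) r) n L /\ ~ L (a1, a2) /\ ~ L (b1, b2)) <->
    ((exists C, real_oval (a1, a2) (b1, b2) a r n C /\ normals C L) /\
     ~ same L (line_through (a1, a2) (o1, o2)))).
  { intros L. rewrite real_oval_normals by assumption. split.
    - intros (HR & HA & HB). split.
      + now apply (oval_of_refracted_ray o1 o2).
      + intros K. apply HA, K. apply line_origin.
    - intros [(sigma1 & sigma2 & x & y & S1 & S2 & HA & HB & HO & HL) HN].
      destruct (refracted_ray_of_oval o1 o2 r a1 a2 b1 b2 a n hr ha har hn hq hb1 hb2
        L sigma1 sigma2 x y S1 S2 HA HB HO HL) as [HR HAB].
      tauto. }
  (* The axis contains both foci, so [Eq] leaves it out on both sides; the envelope clauses need it
     back on both sides. *)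
  assert (Ax : forall L : pset, same L (line_through (a1, a2) (o1, o2)) ->
    refracted_rays (a1, a2) (circle (o1, o2) r) n L /\
    exists C, real_oval (a1, a2) (b1, b2) a r n C /\ normals C L).
  { intros L HL. split.
    - now apply (axis_refracted o1 o2 r a1 a2 a n).
    - apply real_oval_normals; try assumption.
      now apply (axis_normal o1 o2 r a1 a2 b1 b2 a n). }
  assert (Env : forall f g : pset -> Prop, (forall L, f L <-> g L) ->
    forall E, is_envelope f E <-> is_envelope g E).
  { intros f g H E. unfold is_envelope. split; intros (H1 & H2 & H3); split;
      try assumption; split.
    - intros L HL. apply H2, H, HL.
    - intros P HP. destruct (H3 P HP) as (L & HL & HT). exists L. now rewrite <- H.
    - intros L HL. apply H2, H, HL.
    - intros P HP. destruct (H3 P HP) as (L & HL & HT). exists L. now rewrite H. }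
  (* The two families are equal as sets of lines, so their envelopes agree without any study of
     tangency. *)
  assert (Fam : forall L : pset,
    refracted_rays (a1, a2) (circle (o1, o2) r) n L /\
      (~ L (a1, a2) /\ ~ L (b1, b2) \/ same L (line_through (a1, a2) (o1, o2))) <->
    normals (real_ovals_union (a1, a2) (b1, b2) a r n) L).
  { intros L. rewrite normals_union by assumption.
    pose proof (Eq L). pose proof (Ax L).
    destruct (classic (same L (line_through (a1, a2) (o1, o2)))); tauto. }
  split; [exact Eq | split].
  - intros E. now apply Env.
  - intros Hn1 Hnar E. apply Env. intros L. rewrite <- Fam.
    split; [| tauto]. intros HR. split; [assumption |].
    pose proof (ray_through_focus o1 o2 r a1 a2 b1 b2 a n hr ha har hq hb1 hb2 L
      Hn1 Hnar HR).
    destruct (classic (L (a1, a2))), (classic (L (b1, b2))); tauto.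
Qed.
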